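(* Let $\gamma \geq 0$ be an integer. The operad $\mathsf{As}_\gamma$ is the vector space of $\gamma$-corollas, and its partial compositions satisfy, for any $\gamma$-corollas $\mathfrak{c}_1$ and $\mathfrak{c}_2$, $\mathfrak{c}_1 \circ_i \mathfrak{c}_2 = \mathfrak{c}_1 \star \mathfrak{c}_2$ for all valid integers $i$. Besides, $\mathsf{As}_\gamma$ is a Koszul operad, and the set of right comb syntax trees of $\mathbf{Free}(\{\star_a : a \in [\gamma]\})$ in which all internal nodes have a same label forms a Poincaré-Birkhoff-Witt basis of $\mathsf{As}_\gamma$.
   Context: The ground field has characteristic zero; operad means nonsymmetric operad; $[\gamma] = \{1, \dots, \gamma\}$; $a \uparrow a' := \max(a, a')$. $\mathsf{As}_\gamma$ is the operad $\mathbf{Free}(\{\star_a : a \in [\gamma]\})/\langle \mathfrak{R} \rangle$, where $\mathbf{Free}(\{\star_a\})$ is the free operad on binary generators $\star_a$ (spanned by syntax trees, that is, planar binary trees with internal nodes labeled by the generators) and $\mathfrak{R}$ is the space generated by $\star_a \circ_1 \star_{a'} - \star_{a \uparrow a'} \circ_2 \star_{a \uparrow a'}$ and $\star_a \circ_2 \star_{a'} - \star_{a \uparrow a'} \circ_2 \star_{a \uparrow a'}$, for all $a, a' \in [\gamma]$. ''$\mathsf{As}_\gamma$ is the vector space of...'' means it is isomorphic, as an operad, to that graded space with the given partial compositions. A $\gamma$-corolla is a planar rooted tree with at most one internal node, this internal node being labeled by an element of $[\gamma]$ and having at least two children, all leaves; its arity is its number of leaves. The only $\gamma$-corolla of arity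 $1$ is the leaf, the unit of the operad. For $\gamma$-corollas $\mathfrak{c}_1, \mathfrak{c}_2$ with $n$ and $m$ leaves and labels $a$ and $a'$, $\mathfrak{c}_1 \star \mathfrak{c}_2$ is the $\gamma$-corolla with $n + m - 1$ leaves labeled by $a \uparrow a'$ (if one of the two is the leaf, the result is the other one). A right comb syntax tree is one in which every left child of an internal node is a leaf. A quadratic operad is Koszul if its Koszul complex is acyclic (Ginzburg–Kapranov). Poincaré-Birkhoff-Witt bases are those of Hoffbeck, used in the following form for set-operads: if $\to$ is a convergent (terminating and confluent) quadratic rewrite rule on syntax trees on a graded set $S$ and $\mathcal{O}$ is isomorphic to the quotient of the free set-operad on $S$ by the operad congruence induced by $\to$, then the set of normal forms of $\to$ is a Poincaré-Birkhoff-Witt basis of $\mathcal{O}$. *)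

(* Defs.v *)
From HB Require Import structures.
From mathcomp Require Import all_boot all_order all_algebra.
From mathcomp Require Import generic_quotient.
From mathcomp Require Import finmap monalg.
From mathcomp Require Import boolp zify.

Set Implicit Arguments.
Unset Strict Implicit.
Unset Printing Implicit Defensive.

Import Order.TTheory GRing.Theory.
Local Open Scope ring_scope.
Local Open Scope quotient_scope.

Definition fmod (K : fieldType) (S : choiceType) : lmodType K := {malg K[S]}.

Section FreeModule.
Context {K : fieldType} {S : choiceType}.

Definition supp (x : fmod K S) : {fset S} := msupp (x : {malg K[S]}).
Definition coef (s : S) (x : fmod K S) : K := (x : {malg K[S]})@_s.
Definition basis (s : S) : fmod K S := << s >>.

Lemma coefP (x y : fmod K S) : (forall s, coef s x = coef s y) <-> x = y.
Proof. exact: malgP. Qed.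

Lemma coef_is_linear s : linear (coef s : fmod K S -> K^o).
Proof. by move=> a x y; rewrite /coef mcoeffD mcoeffZ. Qed.

HB.instance Definition _ s :=
  GRing.isLinear.Build K (fmod K S) K^o *:%R (coef s) (coef_is_linear s).

Lemma coefD s x y : coef s (x + y) = coef s x + coef s y. Proof. exact: mcoeffD. Qed.
Lemma coefZ s a x : coef s (a *: x) = a * coef s x. Proof. exact: mcoeffZ. Qed.

Lemma coef_basis s t : coef t (basis s) = (s == t)%:R. Proof. exact: mcoeffU. Qed.

Lemma supp_coef x s : (s \in supp x) = (coef s x != 0).
Proof. by rewrite -mcoeff_neq0. Qed.

Lemma fmodE (x : fmod K S) : x = \sum_(s <- supp x) coef s x *: basis s.
Proof.
rewrite [LHS]monalgE; apply: eq_bigr => s _; apply/coefP => t.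
by rewrite coefZ coef_basis mulr_natr; apply: mcoeffU.
Qed.

End FreeModule.

HB.lock Definition mlift (K : fieldType) (S : choiceType) (V : lmodType K)
  (f : S -> V) (x : fmod K S) : V := \sum_(s <- supp x) coef s x *: f s.

Section LinearExtension.
Context {K : fieldType} {S : choiceType} {V : lmodType K}.
Implicit Types (f : S -> V) (x y : fmod K S).

Lemma mliftE f x : mlift f x = \sum_(s <- supp x) coef s x *: f s.
Proof. by rewrite mlift.unlock. Qed.

Lemma mliftEw f x (d : {fset S}) : (supp x `<=` d)%fset ->
  mlift f x = \sum_(s <- d) coef s x *: f s.
Proof.
move=> le_d; rewrite mliftE (big_fset_incl _ le_d) // => s _.
by rewrite supp_coef negbK => /eqP ->; rewrite scale0r.
Qed.

Lemma mlift_is_linear f : linear (mlift f).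
Proof.
move=> a x y; set d := (supp x `|` supp y)%fset.
rewrite (@mliftEw _ x d) ?fsubsetUl // (@mliftEw _ y d) ?fsubsetUr //.
rewrite (@mliftEw _ _ d); last first.
  by apply: (fsubset_trans (msuppD_le _ _)); apply/fsetSU/msuppZ_le.
rewrite scaler_sumr -big_split /=; apply: eq_bigr => s _.
by rewrite coefD coefZ scalerDl scalerA.
Qed.

HB.instance Definition _ f :=
  GRing.isLinear.Build K (fmod K S) V *:%R (mlift f) (mlift_is_linear f).

Lemma mlift_basis f s : mlift f (basis s) = f s.
Proof.
rewrite (@mliftEw _ _ [fset s]%fset) ?msuppU_le //.
by rewrite big_seq_fset1 coef_basis eqxx scale1r.
Qed.

Lemma mlift_combE a f g x :
  mlift (fun s => a *: f s + g s) x = a *: mlift f x + mlift g x.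
Proof.
rewrite !mliftE scaler_sumr -big_split /=; apply: eq_bigr => s _.
by rewrite scalerDr !scalerA mulrC.
Qed.

Lemma eq_mlift f g : f =1 g -> mlift f =1 mlift g.
Proof. by move=> fg x; rewrite !mliftE; apply: eq_bigr => s _; rewrite fg. Qed.

Lemma linear_ext (h1 h2 : fmod K S -> V) : linear h1 -> linear h2 ->
  (forall s, h1 (basis s) = h2 (basis s)) -> h1 =1 h2.
Proof.
move=> l1 l2 h12 x.
have z1 : h1 0 = 0 by have := l1 (-1) 0 0; rewrite scaleN1r oppr0 addr0 scaleN1r addNr.
have z2 : h2 0 = 0 by have := l2 (-1) 0 0; rewrite scaleN1r oppr0 addr0 scaleN1r addNr.
rewrite (fmodE x); elim: (X in \sum_(k <- X) _) => [|s r IHr].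
  by rewrite big_nil z1 z2.
by rewrite big_cons l1 l2 h12 IHr.
Qed.

End LinearExtension.

Section Quotient.
Context {K : fieldType} {V : lmodType K}.

Inductive span (X : V -> Prop) : V -> Prop :=
| span0 : span X 0
| span_cons a x y : X x -> span X y -> span X (a *: x + y).

Variable X : V -> Prop.

Lemma span_sub x : X x -> span X x.
Proof. by move=> Xx; rewrite -[x]scale1r -[_ *: _]addr0; do 2?constructor. Qed.

Lemma spanD x y : span X x -> span X y -> span X (x + y).
Proof.
by move=> Xx Xy; elim: Xx => [|a u v Xu _]; rewrite ?add0r // -addrA; constructor.
Qed.

Lemma spanZ a x : span X x -> span X (a *: x).
Proof.
elim=> [|b u v Xu _ IH]; first by rewrite scaler0; constructor.
by rewrite scalerDr scalerA; constructor.
Qed.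

Lemma spanN x : span X x -> span X (- x).
Proof. by rewrite -scaleN1r; apply: spanZ. Qed.

Lemma span_comb (x1 x2 x3 y1 y2 y3 z1 z2 z3 : V) (a e : K) :
  span X (x3 - (a *: x1 + x2)) -> span X (y3 - (a *: y1 + y2)) ->
  span X (z3 - (a *: z1 + z2)) ->
  span X (x3 - y3 - e *: z3 - (a *: (x1 - y1 - e *: z1) + (x2 - y2 - e *: z2))).
Proof.
move=> hx hy hz.
have E1 (u1 u2 v1 v2 : V) : (u1 - v1) + (u2 - v2) = (u1 + u2) - (v1 + v2).
  by rewrite opprD addrACA.
have E2 (u1 u2 v1 v2 : V) : (u1 - v1) - (u2 - v2) = (u1 - u2) - (v1 - v2).
  by rewrite !opprD !opprK addrACA.
have E3 : a *: (e *: z1) = e *: (a *: z1) by rewrite !scalerA mulrC.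
rewrite !scalerBr E3 E1 E1 -scalerDr E2 -scalerBr [x3 - y3 - _]E2.
by apply: spanD; [apply: spanD => // |]; apply: spanN => //; apply: spanZ.
Qed.

Definition quot_rel (x y : V) : bool := `[< span X (x - y) >].

Lemma quot_rel_refl : reflexive quot_rel.
Proof. by move=> x; apply/asboolP; rewrite subrr; constructor. Qed.

Lemma quot_rel_sym : symmetric quot_rel.
Proof. by move=> x y; apply/asboolP/asboolP => /spanN; rewrite opprB. Qed.

Lemma quot_rel_trans : transitive quot_rel.
Proof.
move=> y x z /asboolP xy /asboolP yz; apply/asboolP.
by rewrite -[x](subrK y) -addrA; apply: spanD.
Qed.

Canonical quot_equiv := EquivRel quot_rel quot_rel_refl quot_rel_sym quot_rel_trans.

Definition quot := {eq_quot quot_rel}.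
HB.instance Definition _ := Choice.on quot.

Definition quot_pi (x : V) : quot := \pi_{eq_quot quot_rel} x.
Definition quot_repr (q : quot) : V := repr (q : {eq_quot quot_rel}).

Lemma quot_reprK q : quot_pi (quot_repr q) = q.
Proof. exact: reprK. Qed.

Lemma quot_piP x y : quot_pi x = quot_pi y <-> span X (x - y).
Proof.
split; first by move/eqquotP/asboolP.
by move=> h; apply/eqquotP/asboolP.
Qed.

Lemma quot_pi_repr x : span X (quot_repr (quot_pi x) - x).
Proof. by apply/quot_piP; rewrite quot_reprK. Qed.

Definition quot_add q r := quot_pi (quot_repr q + quot_repr r).
Definition quot_opp q := quot_pi (- quot_repr q).
Definition quot_scale a q := quot_pi (a *: quot_repr q).

Lemma quot_addE x y : quot_add (quot_pi x) (quot_pi y) = quot_pi (x + y).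
Proof. by apply/quot_piP; rewrite opprD addrACA; apply: spanD; apply: quot_pi_repr. Qed.

Lemma quot_oppE x : quot_opp (quot_pi x) = quot_pi (- x).
Proof. by apply/quot_piP; rewrite -opprD; apply/spanN/quot_pi_repr. Qed.

Lemma quot_scaleE a x : quot_scale a (quot_pi x) = quot_pi (a *: x).
Proof. by apply/quot_piP; rewrite -scalerBr; apply/spanZ/quot_pi_repr. Qed.

Lemma quot_ind (P : quot -> Prop) : (forall x, P (quot_pi x)) -> forall q, P q.
Proof. by move=> Ppi q; rewrite -[q]quot_reprK. Qed.

Lemma quot_addA : associative quot_add.
Proof. by do 3!elim/quot_ind=> ?; rewrite !quot_addE addrA. Qed.
Lemma quot_addC : commutative quot_add.
Proof. by do 2!elim/quot_ind=> ?; rewrite !quot_addE addrC. Qed.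
Lemma quot_add0 : left_id (quot_pi 0) quot_add.
Proof. by elim/quot_ind=> ?; rewrite !quot_addE add0r. Qed.
Lemma quot_addN : left_inverse (quot_pi 0) quot_opp quot_add.
Proof. by elim/quot_ind=> ?; rewrite quot_oppE !quot_addE addNr. Qed.

HB.instance Definition _ :=
  GRing.isZmodule.Build quot quot_addA quot_addC quot_add0 quot_addN.

Lemma quot_scaleA a b q : quot_scale a (quot_scale b q) = quot_scale (a * b) q.
Proof. by elim/quot_ind: q => ?; rewrite !quot_scaleE scalerA. Qed.
Lemma quot_scale1 : left_id 1 quot_scale.
Proof. by elim/quot_ind=> ?; rewrite !quot_scaleE scale1r. Qed.
Lemma quot_scaleDr : right_distributive quot_scale +%R.
Proof.
by move=> a; do 2!elim/quot_ind=> ?; rewrite /+%R /= !(quot_addE, quot_scaleE) scalerDr.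
Qed.
Lemma quot_scaleDl q : {morph quot_scale^~ q : a b / a + b}.
Proof.
by elim/quot_ind: q => ? a b; rewrite [RHS]/+%R /= !(quot_addE, quot_scaleE) scalerDl.
Qed.

HB.instance Definition _ := GRing.Zmodule_isLmodule.Build K quot
  quot_scaleA quot_scale1 quot_scaleDr quot_scaleDl.

Lemma quot_pi_is_linear : linear quot_pi.
Proof. by move=> a x y; rewrite -quot_addE -quot_scaleE. Qed.

HB.instance Definition _ :=
  GRing.isLinear.Build K V quot *:%R quot_pi quot_pi_is_linear.

End Quotient.
Arguments quot_pi {K V} X x.

(* A nonsymmetric set-operad, as a set with an arity function.  Inputs are
   numbered from 0, and so_comp x i y is only meaningful for i < so_ar x. *)
Record set_operad := SetOperad {
  so_car :> choiceType;
  so_ar : so_car -> nat;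
  so_one : so_car;
  so_comp : so_car -> nat -> so_car -> so_car;
  so_ar_one : so_ar so_one = 1%N;
  so_ar_comp : forall x i y, (i < so_ar x)%N ->
    ((so_ar (so_comp x i y)).+1 = so_ar x + so_ar y)%N;
  so_comp1x : forall x, so_comp so_one 0 x = x;
  so_compx1 : forall x i, (i < so_ar x)%N -> so_comp x i so_one = x;
  so_comp_seq : forall x y z i j, (i < so_ar x)%N -> (j < so_ar y)%N ->
    so_comp (so_comp x i y) (i + j) z = so_comp x i (so_comp y j z);
  so_comp_par : forall x y z i k, (i < k < so_ar x)%N ->
    so_comp (so_comp x i y) (k + so_ar y).-1 z = so_comp (so_comp x k z) i y
}.

(* A nonsymmetric K-linear operad.  The arity p = n + m - 1 of a partial
   composition is a separate index constrained by an equation, so that the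
   axioms need no transport between components. *)
Record operad (K : fieldType) := Operad {
  op_car :> nat -> lmodType K;
  op_one : op_car 1%N;
  op_comp : forall n m p, (p.+1 = n + m)%N -> 'I_n -> op_car n -> op_car m -> op_car p;
  op_compDl : forall n m p (e : (p.+1 = n + m)%N) (i : 'I_n) y,
    linear (fun x => op_comp e i x y);
  op_compDr : forall n m p (e : (p.+1 = n + m)%N) (i : 'I_n) x,
    linear (op_comp e i x);
  op_comp1x : forall n (e : (n.+1 = 1 + n)%N) (i : 'I_1) x, op_comp e i op_one x = x;
  op_compx1 : forall n (e : (n.+1 = n + 1)%N) (i : 'I_n) x, op_comp e i x op_one = x;
  op_comp_seq : forall n m l p q r
    (e1 : (p.+1 = n + m)%N) (e2 : (r.+1 = p + l)%N)
    (e3 : (q.+1 = m + l)%N) (e4 : (r.+1 = n + q)%N)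
    (i : 'I_n) (j : 'I_m) (h : 'I_p) x y z, h = (i + j)%N :> nat ->
    op_comp e2 h (op_comp e1 i x y) z = op_comp e4 i x (op_comp e3 j y z);
  op_comp_par : forall n m l p q r
    (e1 : (p.+1 = n + m)%N) (e2 : (r.+1 = p + l)%N)
    (e3 : (q.+1 = n + l)%N) (e4 : (r.+1 = q + m)%N)
    (i k : 'I_n) (h : 'I_p) (i' : 'I_q) x y z,
    (i < k)%N -> h = (k + m).-1 :> nat -> i' = i :> nat ->
    op_comp e2 h (op_comp e1 i x y) z = op_comp e4 i' (op_comp e3 k x z) y
}.
Arguments op_one {K} o.
Arguments op_comp {K} o {n m p} e i x y.

Definition operad_iso (K : fieldType) (O O' : operad K) : Prop :=
  exists f : forall n, {linear O n -> O' n},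
    [/\ forall n, bijective (f n),
        f 1%N (op_one O) = op_one O'
      & forall n m p (e : (p.+1 = n + m)%N) (i : 'I_n) x y,
          f p (op_comp O e i x y) = op_comp O' e i (f n x) (f m y)].

Section Linearization.
Variables (K : fieldType) (S : set_operad).

Definition so_at (n : nat) : choiceType := {x : S | so_ar x == n}.

Lemma so_comp_subproof n m p (e : (p.+1 = n + m)%N) (i : 'I_n) (x : so_at n) (y : so_at m) :
  so_ar (so_comp (val x) i (val y)) == p.
Proof.
have ltix : (i < so_ar (val x))%N by rewrite (eqP (valP x)).
by rewrite -eqSS so_ar_comp // (eqP (valP x)) (eqP (valP y)) e.
Qed.

Definition so_comp_at n m p (e : (p.+1 = n + m)%N) (i : 'I_n)
  (x : so_at n) (y : so_at m) : so_at p :=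
  exist (fun z : S => so_ar z == p) _ (so_comp_subproof e i x y).

Definition so_one_at : so_at 1%N :=
  exist (fun z : S => so_ar z == 1%N) (so_one S) (introT eqP (so_ar_one S)).

Definition lin_car (n : nat) : lmodType K := fmod K (so_at n).

Definition lin_comp n m p (e : (p.+1 = n + m)%N) (i : 'I_n)
    (x : lin_car n) (y : lin_car m) : lin_car p :=
  mlift (fun s => mlift (fun t => (basis (so_comp_at e i s t)) : lin_car p) y) x.

Lemma lin_compU n m p (e : (p.+1 = n + m)%N) (i : 'I_n) (s : so_at n) (t : so_at m) :
  lin_comp e i (basis s) (basis t) = (basis (so_comp_at e i s t)).
Proof. by rewrite /lin_comp !mlift_basis. Qed.

Lemma lin_compDl n m p (e : (p.+1 = n + m)%N) (i : 'I_n) (y : lin_car m) :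
  linear (fun x : lin_car n => lin_comp e i x y).
Proof. by move=> a x x'; rewrite /lin_comp linearP. Qed.

Lemma lin_compDr n m p (e : (p.+1 = n + m)%N) (i : 'I_n) (x : lin_car n) :
  linear (lin_comp e i x : lin_car m -> lin_car p).
Proof.
move=> a y y'; rewrite /lin_comp -mlift_combE.
by apply: eq_mlift => s; rewrite linearP.
Qed.

Lemma lin_comp1x n (e : (n.+1 = 1 + n)%N) (i : 'I_1) (x : lin_car n) :
  lin_comp e i (basis so_one_at) x = x.
Proof.
apply: (@linear_ext _ _ _ (lin_comp e i (basis so_one_at)) id) => // [|s].
  exact: lin_compDr.
by rewrite lin_compU; congr basis; apply: val_inj; rewrite /= (ord1 i) so_comp1x.
Qed.

Lemma lin_compx1 n (e : (n.+1 = n + 1)%N) (i : 'I_n) (x : lin_car n) :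
  lin_comp e i x (basis so_one_at) = x.
Proof.
apply: (@linear_ext _ _ _ (fun x => lin_comp e i x (basis so_one_at)) id) => // [|s].
  exact: lin_compDl.
rewrite lin_compU; congr basis; apply: val_inj; rewrite /= so_compx1 //.
by rewrite (eqP (valP s)).
Qed.

Lemma lin_comp_seq n m l p q r
    (e1 : (p.+1 = n + m)%N) (e2 : (r.+1 = p + l)%N)
    (e3 : (q.+1 = m + l)%N) (e4 : (r.+1 = n + q)%N)
    (i : 'I_n) (j : 'I_m) (h : 'I_p) (x : lin_car n) (y : lin_car m) (z : lin_car l) :
  h = (i + j)%N :> nat ->
  lin_comp e2 h (lin_comp e1 i x y) z = lin_comp e4 i x (lin_comp e3 j y z).
Proof.
move=> hE; move: x.
apply: linear_ext => [a u v|a u v|s]; rewrite ?lin_compDl //.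
move: y; apply: linear_ext => [a u v|a u v|t].
- by rewrite lin_compDr lin_compDl.
- by rewrite lin_compDl lin_compDr.
move: z; apply: linear_ext => [a u v|a u v|w]; rewrite ?lin_compDr //.
rewrite !lin_compU; congr basis; apply: val_inj; rewrite /= hE so_comp_seq //.
  by rewrite (eqP (valP s)).
by rewrite (eqP (valP t)).
Qed.

Lemma lin_comp_par n m l p q r
    (e1 : (p.+1 = n + m)%N) (e2 : (r.+1 = p + l)%N)
    (e3 : (q.+1 = n + l)%N) (e4 : (r.+1 = q + m)%N)
    (i k : 'I_n) (h : 'I_p) (i' : 'I_q) (x : lin_car n) (y : lin_car m) (z : lin_car l) :
  (i < k)%N -> h = (k + m).-1 :> nat -> i' = i :> nat ->
  lin_comp e2 h (lin_comp e1 i x y) z = lin_comp e4 i' (lin_comp e3 k x z) y.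
Proof.
move=> ltik hE iE; move: x.
apply: linear_ext => [a u v|a u v|s]; rewrite ?lin_compDl //.
move: y; apply: linear_ext => [a u v|a u v|t].
- by rewrite lin_compDr lin_compDl.
- by rewrite lin_compDr.
move: z; apply: linear_ext => [a u v|a u v|w].
- by rewrite lin_compDr.
- by rewrite lin_compDr lin_compDl.
rewrite !lin_compU; congr basis; apply: val_inj; rewrite /= hE iE.
have -> : (k + m).-1 = (k + so_ar (val t)).-1 by rewrite (eqP (valP t)).
rewrite so_comp_par //.
by rewrite ltik (eqP (valP s)) /=.
Qed.

Definition lin_operad : operad K :=
  Operad lin_compDl lin_compDr lin_comp1x lin_compx1 lin_comp_seq lin_comp_par.

End Linearization.

Section QuotientOperad.
Variables (K : fieldType) (O : operad K) (R : forall n, O n -> Prop).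

Inductive ideal : forall n, O n -> Prop :=
| ideal_rel n (x : O n) : R x -> ideal x
| ideal0 n : ideal (0 : O n)
| idealP n a (x y : O n) : ideal x -> ideal y -> ideal (a *: x + y)
| ideal_compl n m p (e : (p.+1 = n + m)%N) (i : 'I_n) (x : O n) (y : O m) :
    ideal x -> ideal (op_comp O e i x y)
| ideal_compr n m p (e : (p.+1 = n + m)%N) (i : 'I_n) (x : O n) (y : O m) :
    ideal y -> ideal (op_comp O e i x y).

Lemma span_ideal n (x : O n) : span (@ideal n) x -> ideal x.
Proof. by elim=> [|a u v Iu _ Iv]; [exact: ideal0 | exact: idealP]. Qed.

Definition qop_car (n : nat) : lmodType K := quot (@ideal n).

Lemma qop_ind n (P : qop_car n -> Prop) :
  (forall x : O n, P (quot_pi _ x)) -> forall q, P q.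
Proof. exact: quot_ind. Qed.

Definition qop_comp n m p (e : (p.+1 = n + m)%N) (i : 'I_n)
    (x : qop_car n) (y : qop_car m) : qop_car p :=
  quot_pi _ (op_comp O e i (quot_repr x) (quot_repr y)).

Lemma qop_compE n m p (e : (p.+1 = n + m)%N) (i : 'I_n) (x : O n) (y : O m) :
  qop_comp e i (quot_pi _ x) (quot_pi _ y) = quot_pi _ (op_comp O e i x y).
Proof.
apply/quot_piP; set x' := quot_repr _; set y' := quot_repr _.
have -> : op_comp O e i x' y' - op_comp O e i x y =
    op_comp O e i (x' - x) y' + op_comp O e i x (y' - y).
  have := op_compDl e i y' (-1) x x'; rewrite !scaleN1r [_ + x']addrC => ->.
  have := op_compDr e i x (-1) y y'; rewrite !scaleN1r [_ + y']addrC => ->.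
  by rewrite [RHS]addrC -addrA addNKr addrC.
apply/spanD; apply: span_sub.
  by apply: ideal_compl; apply/span_ideal/quot_pi_repr.
by apply: ideal_compr; apply/span_ideal/quot_pi_repr.
Qed.

Lemma qop_compDl n m p (e : (p.+1 = n + m)%N) (i : 'I_n) (y : qop_car m) :
  linear (fun x : qop_car n => qop_comp e i x y).
Proof.
move=> a x x'; elim/qop_ind: x => x; elim/qop_ind: x' => x'; elim/qop_ind: y => y.
by rewrite -linearP !qop_compE -linearP op_compDl.
Qed.

Lemma qop_compDr n m p (e : (p.+1 = n + m)%N) (i : 'I_n) (x : qop_car n) :
  linear (qop_comp e i x : qop_car m -> qop_car p).
Proof.
move=> a y y'; elim/qop_ind: x => x; elim/qop_ind: y => y; elim/qop_ind: y' => y'.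
by rewrite -linearP !qop_compE -linearP op_compDr.
Qed.

Lemma qop_comp1x n (e : (n.+1 = 1 + n)%N) (i : 'I_1) (x : qop_car n) :
  qop_comp e i (quot_pi _ (op_one O)) x = x.
Proof. by elim/qop_ind: x => x; rewrite qop_compE op_comp1x. Qed.

Lemma qop_compx1 n (e : (n.+1 = n + 1)%N) (i : 'I_n) (x : qop_car n) :
  qop_comp e i x (quot_pi _ (op_one O)) = x.
Proof. by elim/qop_ind: x => x; rewrite qop_compE op_compx1. Qed.

Lemma qop_comp_seq n m l p q r
    (e1 : (p.+1 = n + m)%N) (e2 : (r.+1 = p + l)%N)
    (e3 : (q.+1 = m + l)%N) (e4 : (r.+1 = n + q)%N)
    (i : 'I_n) (j : 'I_m) (h : 'I_p) (x : qop_car n) (y : qop_car m) (z : qop_car l) :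
  h = (i + j)%N :> nat ->
  qop_comp e2 h (qop_comp e1 i x y) z = qop_comp e4 i x (qop_comp e3 j y z).
Proof.
move=> hE; elim/qop_ind: x => x; elim/qop_ind: y => y; elim/qop_ind: z => z.
by rewrite !qop_compE; congr (quot_pi _ _); apply: op_comp_seq.
Qed.

Lemma qop_comp_par n m l p q r
    (e1 : (p.+1 = n + m)%N) (e2 : (r.+1 = p + l)%N)
    (e3 : (q.+1 = n + l)%N) (e4 : (r.+1 = q + m)%N)
    (i k : 'I_n) (h : 'I_p) (i' : 'I_q) (x : qop_car n) (y : qop_car m) (z : qop_car l) :
  (i < k)%N -> h = (k + m).-1 :> nat -> i' = i :> nat ->
  qop_comp e2 h (qop_comp e1 i x y) z = qop_comp e4 i' (qop_comp e3 k x z) y.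
Proof.
move=> ltik hE iE; elim/qop_ind: x => x; elim/qop_ind: y => y; elim/qop_ind: z => z.
by rewrite !qop_compE; congr (quot_pi _ _); apply: op_comp_par.
Qed.

Definition quot_operad : operad K :=
  Operad qop_compDl qop_compDr qop_comp1x qop_compx1 qop_comp_seq qop_comp_par.

End QuotientOperad.

(* Planar binary trees with internal nodes in G and leaves in A. *)
Inductive btree (G A : Type) : Type :=
| Lf of A
| Nd of G & btree G A & btree G A.
Arguments Lf {G A} _.
Arguments Nd {G A} _ _ _.

Section BtreeChoice.
Variables G A : choiceType.

Fixpoint btree_encode (t : btree G A) : GenTree.tree (G + A) :=
  match t with
  | Lf x => GenTree.Leaf (inr x)
  | Nd g l r =>
      GenTree.Node 0 [:: GenTree.Leaf (inl g); btree_encode l; btree_encode r]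
  end.

Fixpoint btree_decode (t : GenTree.tree (G + A)) : option (btree G A) :=
  match t with
  | GenTree.Leaf (inr x) => Some (Lf x)
  | GenTree.Node _ [:: GenTree.Leaf (inl g); l; r] =>
      if (btree_decode l, btree_decode r) is (Some l', Some r')
      then Some (Nd g l' r') else None
  | _ => None
  end.

Lemma btree_encodeK : pcancel btree_encode btree_decode.
Proof. by elim=> //= g l -> r ->. Qed.

HB.instance Definition _ := Choice.copy (btree G A) (pcan_type btree_encodeK).
End BtreeChoice.

Fixpoint nodes (G A : Type) (t : btree G A) : nat :=
  (if t is Nd _ l r then (nodes l + nodes r).+1 else 0)%N.

Fixpoint leaves (G A : Type) (t : btree G A) : nat :=
  (if t is Nd _ l r then leaves l + leaves r else 1)%N.

Fixpoint labels (G A : Type) (t : btree G A) : seq G :=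
  if t is Nd g l r then g :: labels l ++ labels r else [::].

Notation syntax_tree G := (btree G unit).
Definition leaf {G : Type} : syntax_tree G := Lf tt.

Section FreeOperad.
Variable G : choiceType.
Implicit Types t s u : syntax_tree G.

(* Grafting of s on the i-th leaf of t. *)
Fixpoint graft t (i : nat) s : syntax_tree G :=
  match t with
  | Lf _ => s
  | Nd g l r =>
      if (i < leaves l)%N then Nd g (graft l i s) r
      else Nd g l (graft r (i - leaves l) s)
  end.

Lemma leaves_gt0 t : (0 < leaves t)%N.
Proof. by elim: t => //= _ l IHl r _; rewrite addn_gt0 IHl. Qed.

Lemma leaves_graft t i s : (i < leaves t)%N ->
  ((leaves (graft t i s)).+1 = leaves t + leaves s)%N.
Proof.
elim: t i => /= [_ i _|g l IHl r IHr i lti]; first by rewrite add1n.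
case: ltnP => [/IHl e|lei] /=; first by rewrite -addSn e addnAC.
by rewrite -addnS IHr ?addnA // ltn_subLR.
Qed.

Lemma graft_leaf t i : graft t i leaf = t.
Proof.
elim: t i => [[]|g l IHl r IHr i] //=.
by case: ifP; rewrite ?IHl ?IHr.
Qed.

Lemma graft_seq t s u i j : (i < leaves t)%N -> (j < leaves s)%N ->
  graft (graft t i s) (i + j) u = graft t i (graft s j u).
Proof.
move=> + ltj; elim: t i => /= [_ i|g l IHl r IHr i lti].
  by rewrite ltnS leqn0 => /eqP ->.
case: ltnP => [il|li] /=.
  have := leaves_graft s il; case: ltnP => [_ _|le e]; first by rewrite IHl.
  by move: ltj; rewrite -(ltn_add2l (leaves l)) -e; move: il le; lia.
rewrite ifF; last by apply/negbTE; rewrite -leqNgt (leq_trans li) ?leq_addr.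
by rewrite -addnBAC // IHr // ltn_subLR.
Qed.

Lemma graft_par t s u i k : (i < k < leaves t)%N ->
  graft (graft t i s) (k + leaves s).-1 u = graft (graft t k u) i s.
Proof.
have s0 := leaves_gt0 s; have u0 := leaves_gt0 u.
elim: t i k => [_ i k|g l IHl r IHr i k] /= /andP[ik kt]; first by lia.
case: (ltnP i (leaves l)) => il; case: (ltnP k (leaves l)) => kl /=.
- have := leaves_graft s il; have := leaves_graft u kl => e1 e2.
  by rewrite !ifT ?IHl ?ik //; lia.
- have := leaves_graft s il => e.
  rewrite ifF; last by lia.
  rewrite il; congr (Nd _ _ (graft _ _ _)); lia.
- by move: (leq_trans kl il); lia.
- rewrite ifF; last by lia.
  rewrite ifF; last by lia.
  rewrite -IHr; last by lia.
  congr (Nd _ _ (graft _ _ _)); lia.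
Qed.

Definition free_set_operad : set_operad :=
  @SetOperad (syntax_tree G) (@leaves G unit) leaf graft erefl
    leaves_graft (fun _ => erefl) (fun t i _ => graft_leaf t i)
    graft_seq graft_par.

Definition free_operad (K : fieldType) : operad K := lin_operad K free_set_operad.

Definition node_tree (g : G) : so_at free_set_operad 2%N :=
  exist (fun t : free_set_operad => so_ar t == 2%N) (Nd g leaf leaf) (eqxx 2%N).

Definition generator (K : fieldType) (g : G) : free_operad K 2%N := basis (node_tree g).

(* a \circ_1 b for i = 0 and a \circ_2 b for i = 1. *)
Definition quad (K : fieldType) (i : 'I_2) (a b : G) : free_operad K 3%N :=
  op_comp (free_operad K) (erefl : 4 = 2 + 2)%N i (generator K a) (generator K b).

End FreeOperad.

Arguments generator {G} K g.
Arguments quad {G} K i a b.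

Variant in_arity3 (K : fieldType) (O : operad K) (R : O 3%N -> Prop) :
    forall n, O n -> Prop :=
| InArity3 x of R x : @in_arity3 K O R 3%N x.

Definition quadratic_operad (K : fieldType) (G : choiceType)
    (R : free_operad G K 3%N -> Prop) : operad K :=
  quot_operad (@in_arity3 K (free_operad G K) R).

Definition qproj (K : fieldType) (G : choiceType) (R : free_operad G K 3%N -> Prop)
    (n : nat) (x : free_operad G K n) : quadratic_operad R n :=
  quot_pi _ x.

(* The type composite is F(sE) o P, where E is spanned by G and suspensions are left
   implicit: it is spanned by the trees whose internal nodes are elements of G and
   whose leaves are homogeneous elements of P, modulo multilinearity in the leaves.
   Internal nodes have degree 1, and are tensored in prefix order.  The map h embeds
   the generators in P. *)
Section Composite.
Variables (K : fieldType) (G : choiceType) (P : operad K) (h : G -> P 2%N).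

Definition homog : choiceType := {n : nat & P n}.
Definition mk_homog n (x : P n) : homog := existT (fun n => P n : Type) n x.

Definition ttree : choiceType := btree G homog.

Inductive leaf_linear (a : K) : ttree -> ttree -> ttree -> Prop :=
| leaf_linear_Lf n (x y : P n) :
    leaf_linear a (Lf (mk_homog x)) (Lf (mk_homog y)) (Lf (mk_homog (a *: x + y)))
| leaf_linear_l g l1 l2 l3 r : leaf_linear a l1 l2 l3 ->
    leaf_linear a (Nd g l1 r) (Nd g l2 r) (Nd g l3 r)
| leaf_linear_r g l r1 r2 r3 : leaf_linear a r1 r2 r3 ->
    leaf_linear a (Nd g l r1) (Nd g l r2) (Nd g l r3).

Definition multilinear_rel (x : fmod K ttree) : Prop :=
  exists a t1 t2 t3, leaf_linear a t1 t2 t3 /\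
    x = basis t3 - (a *: basis t1 + basis t2).

Definition composite : lmodType K := quot multilinear_rel.

(* g(x, y) = (g \circ_2 y) \circ_1 x, computed in P. *)
Definition op_act (g : G) (x y : homog) : homog :=
  let: existT n u := x in let: existT m v := y in
  mk_homog (op_comp P (erefl : (m + n).+1 = m.+1 + n)%N ord0
    (op_comp P (erefl : m.+2 = 2 + m)%N (lift ord0 ord0) (h g) v) u).

Definition nd_l (g : G) (r : ttree) : fmod K ttree -> fmod K ttree :=
  mlift (fun l => basis (Nd g l r)).
Definition nd_r (g : G) (l : ttree) : fmod K ttree -> fmod K ttree :=
  mlift (fun r => basis (Nd g l r)).

HB.instance Definition _ g r :=
  GRing.Linear.copy (nd_l g r) (mlift (fun l => basis (Nd g l r))).
HB.instance Definition _ g l :=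
  GRing.Linear.copy (nd_r g l) (mlift (fun r => basis (Nd g l r))).

(* The Koszul differential, induced by the twisting morphism sE -> E -> P: the sum,
   over the internal nodes v both of whose children are leaves, of the tree in
   which v is evaluated in P, with sign (-1) to the number of nodes preceding v in
   prefix order (this is the Koszul sign, up to a factor depending only on the
   homological degree). *)
Fixpoint ttree_diff (t : ttree) : fmod K ttree :=
  match t with
  | Lf _ => 0
  | Nd g l r =>
      (match l, r with
       | Lf x, Lf y => basis (Lf (op_act g x y))
       | _, _ => 0
       end)
      - nd_l g r (ttree_diff l)
      - (-1) ^+ nodes l *: nd_r g l (ttree_diff r)
  end.

Lemma leaf_linear_nodes a t1 t2 t3 :
  leaf_linear a t1 t2 t3 -> nodes t1 = nodes t3 /\ nodes t2 = nodes t3.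
Proof. by elim=> //= g l1 l2 l3 r _ [-> ->]. Qed.

Lemma leaf_linear_span a t1 t2 t3 : leaf_linear a t1 t2 t3 ->
  span multilinear_rel (basis t3 - (a *: basis t1 + basis t2)).
Proof. by move=> h3; apply: span_sub; exists a, t1, t2, t3. Qed.

Lemma span_mlift (f : ttree -> fmod K ttree) (x : fmod K ttree) :
  (forall t, span multilinear_rel (f t)) -> span multilinear_rel (mlift f x).
Proof.
move=> fS; rewrite mliftE; elim: (X in \sum_(_ <- X) _) => [|t r IH].
  by rewrite big_nil; apply: span0.
by rewrite big_cons; apply: spanD => //; apply: spanZ.
Qed.

Lemma span_nd_l g r x : span multilinear_rel x -> span multilinear_rel (nd_l g r x).
Proof.
elim=> [|c u v [a [t1 [t2 [t3 [t123 ->]]]]] _ IH]; first by rewrite linear0; apply: span0.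
rewrite linearP linearB /= linearP /= /nd_l !mlift_basis; apply: spanD IH; apply: spanZ.
by apply: leaf_linear_span; apply: leaf_linear_l.
Qed.

Lemma span_nd_r g l x : span multilinear_rel x -> span multilinear_rel (nd_r g l x).
Proof.
elim=> [|c u v [a [t1 [t2 [t3 [t123 ->]]]]] _ IH]; first by rewrite linear0; apply: span0.
rewrite linearP linearB /= linearP /= /nd_r !mlift_basis; apply: spanD IH; apply: spanZ.
by apply: leaf_linear_span; apply: leaf_linear_r.
Qed.

Lemma nd_l_linear_r a g r1 r2 r3 x : leaf_linear a r1 r2 r3 ->
  span multilinear_rel (nd_l g r3 x - (a *: nd_l g r1 x + nd_l g r2 x)).
Proof.
move=> r123; rewrite /nd_l -mlift_combE addrC -scaleN1r -mlift_combE.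
apply: span_mlift => t; rewrite scaleN1r addrC.
by apply: leaf_linear_span; apply: leaf_linear_r.
Qed.

Lemma nd_r_linear_l a g l1 l2 l3 x : leaf_linear a l1 l2 l3 ->
  span multilinear_rel (nd_r g l3 x - (a *: nd_r g l1 x + nd_r g l2 x)).
Proof.
move=> l123; rewrite /nd_r -mlift_combE addrC -scaleN1r -mlift_combE.
apply: span_mlift => t; rewrite scaleN1r addrC.
by apply: leaf_linear_span; apply: leaf_linear_l.
Qed.

Lemma ttree_diff_linear a t1 t2 t3 : leaf_linear a t1 t2 t3 ->
  span multilinear_rel
    (ttree_diff t3 - (a *: ttree_diff t1 + ttree_diff t2)).
Proof.
have z0 : span multilinear_rel (0 - (a *: 0 + 0) : fmod K ttree).
  by rewrite scaler0 addr0 subrr; apply: span0.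
elim=> [n x y|g l1 l2 l3 r l123 IH|g l r1 r2 r3 r123 IH] //=.
- have [-> ->] := leaf_linear_nodes l123; apply: span_comb.
  + case: l123 {IH} => [n x y|? ? ? ? ? _|? ? ? ? ? _] //.
    case: r => [[m v]|? ? ?] //=; apply: leaf_linear_span.
    by rewrite op_compDr; apply: leaf_linear_Lf.
  + by rewrite -linearP -linearB; apply: span_nd_l.
  + exact: nd_r_linear_l.
- apply: span_comb.
  + case: l => [[m v]|? ? ?] //.
    case: r123 {IH} => [n x y|? ? ? ? ? _|? ? ? ? ? _] //=; apply: leaf_linear_span.
    by rewrite op_compDr op_compDl; apply: leaf_linear_Lf.
  + exact: nd_l_linear_r.
  + by rewrite -linearP -linearB; apply: span_nd_r.
Qed.

Lemma composite_ind (Q : composite -> Prop) :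
  (forall x, Q (quot_pi _ x)) -> forall q, Q q.
Proof. exact: quot_ind. Qed.

Definition composite_diff (q : composite) : composite :=
  quot_pi _ (mlift ttree_diff (quot_repr q)).

Lemma composite_diffE x :
  composite_diff (quot_pi _ x) = quot_pi _ (mlift ttree_diff x).
Proof.
apply/quot_piP; rewrite -linearB; have := quot_pi_repr multilinear_rel x.
move: (_ - x) => z; elim=> [|c u v [a [t1 [t2 [t3 [t123 ->]]]]] _ IH].
  by rewrite linear0; apply: span0.
rewrite linearP linearB /= linearP /= !mlift_basis; apply: spanD IH; apply: spanZ.
exact: ttree_diff_linear.
Qed.

Lemma composite_diff_is_linear : linear composite_diff.
Proof.
move=> a x y; elim/composite_ind: x => x; elim/composite_ind: y => y.
rewrite -(quot_pi_is_linear multilinear_rel) !composite_diffE mlift_is_linear.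
exact: quot_pi_is_linear.
Qed.

HB.instance Definition _ :=
  GRing.isLinear.Build K composite composite *:%R composite_diff composite_diff_is_linear.

End Composite.

Section Koszul.
Variables (K : fieldType) (G : finType) (R : free_operad G K 3%N -> Prop).
Implicit Types t c : syntax_tree G.

Local Notation P := (quadratic_operad R).

Definition tree_coef n (x : free_operad G K n) t : K :=
  if insub t is Some s then coef (s : so_at (free_set_operad G) n) x else 0.

(* The Koszul dual cooperad C(sE, s^2 R), as a subspace of the cofree cooperad on
   sE: for every way of grafting trees t1, t2, t3 on the leaves of a tree with two
   internal nodes, itself grafted on a leaf of a tree c, the corresponding component
   of x has to lie in the span of R.  In the prefix order on the internal nodes,
   which all have degree 1, extracting b from a \circ_2 b moves it over the nodes
   of t1; hence the sign. *)
Definition koszul_dual n (x : free_operad G K n) : Prop :=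
  forall c i t1 t2 t3, (i < leaves c)%N ->
    span R (\sum_(a : G) \sum_(b : G)
      (tree_coef x (graft c i (Nd a (Nd b t1 t2) t3)) *: quad K ord0 a b
       + (-1) ^+ nodes t1
         * tree_coef x (graft c i (Nd a t1 (Nd b t2 t3))) *: quad K (lift ord0 ord0) a b)).

Fixpoint decorate t (p : nat -> homog P) : ttree G P :=
  match t with
  | Lf _ => Lf (p 0%N)
  | Nd g l r => Nd g (decorate l p) (decorate r (fun j => p (leaves l + j)%N))
  end.

(* x \otimes (p_0, ..., p_(n-1)) in the composite. *)
Definition tensor n (x : free_operad G K n) (p : nat -> homog P) : composite G P :=
  quot_pi _ (mlift (fun s : so_at (free_set_operad G) n =>
    basis (decorate (val s) p) : fmod K (ttree G P)) x).

(* The component of homological degree w and arity n of the Koszul complex: the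
   composite of the Koszul dual cooperad C with P, which is the sum of the
   C(w + 1) \otimes P(n_0) \otimes ... \otimes P(n_w) with n_0 + ... + n_w = n. *)
Definition koszul_chain (w n : nat) : composite G P -> Prop :=
  span (fun q => exists (x : free_operad G K w.+1) (p : nat -> homog P),
    [/\ koszul_dual x, (\sum_(j < w.+1) tag (p j) = n)%N & q = tensor x p]).

Definition koszul_diff : composite G P -> composite G P :=
  composite_diff (fun g => qproj R (generator K g)).

(* Acyclicity means that the homology is that of the unit operad: in arity 1 the
   complex is reduced to the unit in degree 0, and it is exact in arities n >= 2.
   In degree w = 0 every chain is a cycle, as trees without nodes have
   differential 0. *)
Definition koszul : Prop :=
  forall n, (1 < n)%N -> forall w z, koszul_chain w n z -> koszul_diff z = 0 ->
    exists2 y, koszul_chain w.+1 n y & koszul_diff y = z.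

End Koszul.

(* The restrictions of t to its internal edges, as trees with two internal nodes. *)
Fixpoint edge_subtrees (G : Type) (t : syntax_tree G) : seq (syntax_tree G) :=
  if t is Nd g l r then
    (if l is Nd h _ _ then [:: Nd g (Nd h leaf leaf) leaf] else [::]) ++
    (if r is Nd h _ _ then [:: Nd g leaf (Nd h leaf leaf)] else [::]) ++
    edge_subtrees l ++ edge_subtrees r
  else [::].

Section PBW.
Variables (K : fieldType) (G : choiceType) (R : free_operad G K 3%N -> Prop).
Variable B : pred (syntax_tree G).

Definition tree_order (le : rel (syntax_tree G)) : Prop :=
  [/\ reflexive le, antisymmetric le, transitive le, total le
    & forall s s' t t' i, leaves s = leaves s' -> leaves t = leaves t' ->
        (i < leaves s)%N -> le s s' -> le t t' -> le (graft s i t) (graft s' i t')].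

(* c is the decomposition on B of the element y of the quotient operad. *)
Definition decomposition n (y : quadratic_operad R n) (c : free_operad G K n) : Prop :=
  {in supp c, forall t, B (val t)} /\ qproj R c = y.

(* Hoffbeck's definition in the nonsymmetric setting: B is a set of tree monomials
   representing a basis of the quotient operad, such that a composite of two elements
   of B is either in B or congruent to a combination of strictly greater elements of
   B, and such that membership in B is detected on internal edges.  The latter
   condition implies that B contains the unit and the generators. *)
Definition PBW_basis : Prop :=
  exists2 le : rel (syntax_tree G), tree_order le &
  [/\ forall n (y : quadratic_operad R n), exists! c, decomposition y c,
      forall s t i n (u : so_at (free_set_operad G) n) c,
        B s -> B t -> (i < leaves s)%N -> val u = graft s i t -> ~~ B (val u) ->
        decomposition (qproj R (basis u : free_operad G K n)) c ->
        {in supp c, forall v, le (val u) (val v) && (val v != val u)}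
    & forall t, B t = all B (edge_subtrees t)].

End PBW.

(* The set [gamma] is represented by 'I_gamma, with its usual order. *)
Section As.
Variables (K : fieldType) (gamma : nat).

Definition lmax (a b : 'I_gamma) : 'I_gamma := Order.max a b.

Definition As_rel (x : free_operad 'I_gamma K 3%N) : Prop :=
  exists a b : 'I_gamma, exists i : 'I_2,
    x = quad K i a b - quad K (lift ord0 ord0) (lmax a b) (lmax a b).

Definition As : operad K := quadratic_operad As_rel.

(* CNode a k is the corolla whose internal node has label a and k + 2 children. *)
Inductive corolla : Type :=
| CLeaf
| CNode of 'I_gamma & nat.

Definition corolla_encode (c : corolla) : option ('I_gamma * nat) :=
  if c is CNode a k then Some (a, k) else None.
Definition corolla_decode (c : option ('I_gamma * nat)) : corolla :=
  if c is Some (a, k) then CNode a k else CLeaf.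
Lemma corolla_encodeK : cancel corolla_encode corolla_decode.
Proof. by case. Qed.
HB.instance Definition _ := Choice.copy corolla (can_type corolla_encodeK).

Definition corolla_ar (c : corolla) : nat := if c is CNode _ k then k.+2 else 1%N.

Definition corolla_star (c d : corolla) : corolla :=
  match c, d with
  | CLeaf, _ => d
  | _, CLeaf => c
  | CNode a k, CNode b l => CNode (lmax a b) (k + l).+1%N
  end.

Lemma corolla_ar_star c i d : (i < corolla_ar c)%N ->
  ((corolla_ar (corolla_star c d)).+1 = corolla_ar c + corolla_ar d)%N.
Proof. by case: c d => [|a k] [|b l] //= _; lia. Qed.

Lemma corolla_starC c d : corolla_star c d = corolla_star d c.
Proof. by case: c d => [|a k] [|b l] //=; rewrite addnC /lmax maxC. Qed.

Lemma corolla_starA : associative corolla_star.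
Proof.
move=> [|a k] [|b l] [|c m] //=.
by rewrite addnS addSn addnA /lmax maxA.
Qed.

Lemma corolla_star1 c : corolla_star c CLeaf = c.
Proof. by case: c. Qed.

Lemma corolla_star_par c d e :
  corolla_star (corolla_star c d) e = corolla_star (corolla_star c e) d.
Proof. by rewrite -!corolla_starA (corolla_starC d). Qed.

Definition corolla_set_operad : set_operad :=
  @SetOperad corolla corolla_ar CLeaf (fun c _ d => corolla_star c d)
    erefl corolla_ar_star (fun _ => erefl) (fun c _ _ => corolla_star1 c)
    (fun c d e _ _ _ _ => esym (corolla_starA c d e))
    (fun c d e _ _ _ => corolla_star_par c d e).

Definition corolla_operad : operad K := lin_operad K corolla_set_operad.

End As.

Fixpoint right_comb (G : Type) (t : syntax_tree G) : bool :=
  match t with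
  | Lf _ => true
  | Nd _ (Lf _) r => right_comb r
  | Nd _ _ _ => false
  end.

Definition monochrome_right_comb (gamma : nat) : pred (syntax_tree 'I_gamma) :=
  fun t => right_comb t && constant (labels t).

(* Main.v *)
From HB Require Import structures.
From mathcomp Require Import all_boot all_order all_algebra.
From mathcomp Require Import finmap boolp zify ring.
Require Import Defs.

(* Modulo the relations, every tree is congruent to the right comb whose nodes all
   carry the maximum of its labels, and the number of leaves together with the
   maximal label is compatible with grafting and with the relations: this gives the
   isomorphism with corollas.  Right combs are maximal among the trees of the same
   arity and with the same maximal label for the path order, hence the PBW basis.

   Koszulness rests on a change of basis.  If e_a is the generator of label a, write
   e_a as the sum of the f_c with a <= c.  In the basis f the relations become
   f_c o f_d = 0 for distinct c, d, and f_c o_1 f_c = f_c o_2 f_c, so that, up to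
   signs, the coordinates of an element of the Koszul dual cooperad are the functions
   on trees that are invariant under the rotation of the edges with both ends of the
   same label.  The differential of the Koszul complex is then the transpose of the
   derivation D of decorated trees that splits a leaf (c, k) into all the pairs
   f_c ((c, i), (c, j)).  Merging a leaf with a unit leaf immediately on its left, at
   the first possible place, is an operator S that is compatible with rotations and
   satisfies D S + S D = 1 outside of the unit tree. *)

Set Implicit Arguments.
Unset Strict Implicit.
Unset Printing Implicit Defensive.

Import Order.TTheory GRing.Theory.
Local Open Scope ring_scope.

(** * Linear maps and quotients *)

(** The obstacle to Koszulness is that [lmax] couples the labels: the quadratic condition on the
    Koszul dual involves at once all the pairs of labels with a given maximum. Since max(a, b) <= c
    holds exactly when a <= c and b <= c, the zeta matrix [label_mx] of the chain of labels turns
    the maximum into a product; it is unitriangular, hence invertible, and this is the origin of the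
    basis f. The Koszul complex is given by spans inside a quotient, where no chain has a canonical
    expression. It is therefore replaced by its coordinates [kappa]: they are jointly injective, and
    the coordinates of the chains of degree w and arity n are exactly, up to [tree_sign], the
    rotation-invariant functions supported on the trees with w + 1 leaves and total arity n. A
    contraction then has to be checked against such functions only. This is essential, because a
    unit leaf and its successor are in general siblings only after some rotations. *)

Section LinearFun.
Variables (K : fieldType) (V W : lmodType K) (f : V -> W).

Lemma linear_fun0 : linear f -> f 0 = 0.
Proof. by move=> /(_ (-1) 0 0); rewrite scaleN1r oppr0 addr0 scaleN1r addNr. Qed.

Lemma linear_funD : linear f -> {morph f : x y / x + y}.
Proof. by move=> fl x y; rewrite -[x]scale1r fl !scale1r. Qed.

Lemma linear_funZ a : linear f -> {morph f : x / a *: x}.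
Proof. by move=> fl x; rewrite -[a *: x]addr0 fl linear_fun0 ?addr0. Qed.

Lemma linear_funB : linear f -> {morph f : x y / x - y}.
Proof.
by move=> fl x y; rewrite -scaleN1r (linear_funD fl) (linear_funZ _ fl) scaleN1r.
Qed.

End LinearFun.

Section QuotientLift.
Variables (K : fieldType) (V W : lmodType K) (X : V -> Prop) (f : {linear V -> W}).
Hypothesis fX : forall x, X x -> f x = 0.

Lemma span_ker x : span X x -> f x = 0.
Proof.
by elim=> [|a u v Xu _ IH]; rewrite ?linear0 // linearP IH addr0 fX // scaler0.
Qed.

Definition quot_lift (q : quot X) : W := f (quot_repr q).

Lemma quot_liftE x : quot_lift (quot_pi X x) = f x.
Proof.
by apply/eqP; rewrite -subr_eq0 -linearB; apply/eqP/span_ker/quot_pi_repr.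
Qed.

Lemma quot_lift_is_linear : linear quot_lift.
Proof.
move=> a x y; rewrite -[x]quot_reprK -[y]quot_reprK.
by rewrite -linearP !quot_liftE linearP.
Qed.

End QuotientLift.

Local Arguments corolla_star : simpl never.

(** * The corolla of a tree *)

Section CorollaOfTree.
Variable gamma : nat.
Local Notation tree := (syntax_tree 'I_gamma).
Implicit Types (t s : tree) (c d : corolla gamma) (a b : 'I_gamma).

Fixpoint tree_corolla t : corolla gamma :=
  if t is Nd g l r then
    corolla_star (CNode g 0) (corolla_star (tree_corolla l) (tree_corolla r))
  else CLeaf gamma.

(** The offset is that of [CNode]: [comb a k] has k + 1 nodes and k + 2 leaves. *)
Fixpoint comb a (k : nat) : tree :=
  Nd a leaf (if k is k'.+1 then comb a k' else leaf).

Definition corolla_comb c : tree := if c is CNode a k then comb a k else leaf.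

Lemma tree_corolla_ar t : corolla_ar (tree_corolla t) = leaves t.
Proof.
elim: t => //= g l <- r <-.
by case: (tree_corolla l) (tree_corolla r) => [|a k] [|b m] //=; lia.
Qed.

Lemma tree_corolla_graft t i s : (i < leaves t)%N ->
  tree_corolla (graft t i s) = corolla_star (tree_corolla t) (tree_corolla s).
Proof.
elim: t i => //= g l IHl r IHr i it; case: ltnP => il /=.
  by rewrite IHl // -!corolla_starA (corolla_starC (tree_corolla s)).
by rewrite IHr ?ltn_subLR // !corolla_starA.
Qed.

Lemma tree_corolla_comb c : tree_corolla (corolla_comb c) = c.
Proof.
case: c => //= a; elim=> //= k ->.
by rewrite /corolla_star /= add0n /lmax maxxx.
Qed.

Lemma leaves_corolla_comb c : leaves (corolla_comb c) = corolla_ar c.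
Proof. by rewrite -tree_corolla_ar tree_corolla_comb. Qed.

End CorollaOfTree.

Section CorollaIso.
Variables (K : fieldType) (gamma : nat).
Local Notation tree := (syntax_tree 'I_gamma).
Local Notation free := (free_operad 'I_gamma K).
Local Notation F := (free_set_operad 'I_gamma).
Local Notation C := (corolla_set_operad gamma).
Local Notation In := (@ideal K free (@in_arity3 K free (@As_rel K gamma))).
Implicit Types (t s : tree) (c d : corolla gamma) (a b : 'I_gamma).

Lemma tree_corolla_at_subproof n (t : so_at F n) :
  so_ar (tree_corolla (val t) : C) == n.
Proof. by rewrite /= tree_corolla_ar; apply: (valP t). Qed.

Definition tree_corolla_at n (t : so_at F n) : so_at C n :=
  exist (fun z : C => so_ar z == n) _ (tree_corolla_at_subproof t).

Lemma corolla_comb_at_subproof n (c : so_at C n) :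
  so_ar (corolla_comb (val c) : F) == n.
Proof. by rewrite /= leaves_corolla_comb; apply: (valP c). Qed.

Definition corolla_comb_at n (c : so_at C n) : so_at F n :=
  exist (fun z : F => so_ar z == n) _ (corolla_comb_at_subproof c).

Lemma corolla_comb_atK n (c : so_at C n) : tree_corolla_at (corolla_comb_at c) = c.
Proof. by apply: val_inj; rewrite /= tree_corolla_comb. Qed.

Definition free_corolla n : free n -> corolla_operad K gamma n :=
  mlift (fun t : so_at F n => (basis (tree_corolla_at t) : lin_car K C n)).

Lemma free_corolla_is_linear n : linear (@free_corolla n).
Proof. exact: mlift_is_linear. Qed.

HB.instance Definition _ n := GRing.isLinear.Build K (free n)
  (corolla_operad K gamma n) *:%R (@free_corolla n) (@free_corolla_is_linear n).

Lemma free_corollaU n (t : so_at F n) :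
  free_corolla (basis t) = basis (tree_corolla_at t).
Proof. by rewrite /free_corolla mlift_basis. Qed.

Lemma free_corolla_comp n m p (e : (p.+1 = n + m)%N) (i : 'I_n) (x : free n) (y : free m) :
  free_corolla (op_comp free e i x y) =
  op_comp (corolla_operad K gamma) e i (free_corolla x) (free_corolla y).
Proof.
move: x; apply: linear_ext => [a u v|a u v|s].
- by rewrite [op_comp _ _ _ _ _]lin_compDl [LHS]free_corolla_is_linear.
- by rewrite [free_corolla _]free_corolla_is_linear [LHS]lin_compDl.
move: y; apply: linear_ext => [a u v|a u v|t].
- by rewrite [op_comp _ _ _ _ _]lin_compDr [LHS]free_corolla_is_linear.
- by rewrite [free_corolla (_ + _)]free_corolla_is_linear [LHS]lin_compDr.
rewrite [op_comp _ _ _ _ _]lin_compU !free_corollaU [RHS]lin_compU.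
congr basis; apply: val_inj => /=.
by rewrite tree_corolla_graft //; have /eqP/= -> := valP s.
Qed.

Lemma free_corolla_quad (i : 'I_2) a b :
  free_corolla (quad K i a b) =
  basis (tree_corolla_at (so_comp_at (erefl : 4 = 2 + 2)%N i (node_tree a) (node_tree b))).
Proof. by rewrite /quad /= lin_compU free_corollaU. Qed.

(** The maximum is idempotent, so both monomials of a relation have the same corolla, with three
    leaves and label [lmax a b]. *)
Lemma free_corolla_rel x : As_rel x -> free_corolla x = 0.
Proof.
case=> a [b [i ->]].
rewrite (linear_funB (@free_corolla_is_linear 3)).
rewrite -> 2!free_corolla_quad.
apply/eqP; rewrite subr_eq0; apply/eqP.
congr basis; apply: val_inj.
have Eg u v k : tree_corolla (so_comp (Nd u leaf leaf : F) k (Nd v leaf leaf : F)) =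
  CNode (lmax u v) 1.
  by rewrite /=; case: ifP => _ //.
rewrite [LHS]Eg [RHS]Eg.
by rewrite /lmax maxxx.
Qed.

Lemma free_corolla_ideal n (x : free n) : In x -> free_corolla x = 0.
Proof.
elim=> {n x} [n _ [x /free_corolla_rel //]|n|n a x y _ x0 _ y0|n m p e i x y _ x0|n m p e i x y _ y0].
- exact: linear_fun0 (@free_corolla_is_linear n).
- by rewrite free_corolla_is_linear x0 y0 scaler0 addr0.
- by rewrite free_corolla_comp x0; apply: linear_fun0 (op_compDl _ _ _).
- by rewrite free_corolla_comp y0; apply: linear_fun0 (op_compDr _ _ _).
Qed.

Definition As_corolla n : As K gamma n -> corolla_operad K gamma n :=
  quot_lift (@free_corolla n).

Lemma As_corolla_is_linear n : linear (@As_corolla n).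
Proof. exact: quot_lift_is_linear (@free_corolla_ideal n). Qed.

HB.instance Definition _ n := GRing.isLinear.Build K (As K gamma n)
  (corolla_operad K gamma n) *:%R (@As_corolla n) (@As_corolla_is_linear n).

Lemma As_corollaE n (x : free n) : As_corolla (qproj (@As_rel K gamma) x) = free_corolla x.
Proof. exact: quot_liftE (@free_corolla_ideal n) x. Qed.

End CorollaIso.

(** * Congruence with right combs *)

Section TreeCongruence.
Variables (K : fieldType) (gamma : nat).
Local Notation tree := (syntax_tree 'I_gamma).
Local Notation free := (free_operad 'I_gamma K).
Local Notation F := (free_set_operad 'I_gamma).
Local Notation In := (@ideal K free (@in_arity3 K free (@As_rel K gamma))).
Implicit Types (t s : tree) (c d : corolla gamma) (a b : 'I_gamma).

Definition tree_at t n (e : leaves t = n) : so_at F n :=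
  exist (fun z : F => so_ar z == n) t (introT eqP e).

(** Quantifying over the elements [u] and [u'] above the two trees, in any arity, allows trees whose
    arities are only provably equal to be compared without transport. *)
Definition tree_eqv s s' : Prop := leaves s = leaves s' /\
  forall n (u u' : so_at F n), val u = s -> val u' = s' ->
    In ((basis u : free n) - (basis u' : free n)).

Lemma tree_eqv_refl s : tree_eqv s s.
Proof.
split=> // n u u' us u's; have -> : u = u' by apply: val_inj; rewrite us.
by rewrite subrr; apply: ideal0.
Qed.

Lemma tree_eqv_trans s' s s'' : tree_eqv s s' -> tree_eqv s' s'' -> tree_eqv s s''.
Proof.
move=> [e1 h1] [e2 h2]; split=> [|n u u'' us us'']; first by rewrite e1.
have e : leaves s' = n by rewrite -e1 -us; apply/eqP: (valP u).
rewrite -[X in In X](subrKA (basis (tree_at e) : free n)).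
rewrite -[X in In (X + _)]scale1r; apply: idealP; first exact: h1.
exact: h2.
Qed.

Lemma tree_eqv_graftr (c : tree) i s s' : (i < leaves c)%N ->
  tree_eqv s s' -> tree_eqv (graft c i s) (graft c i s').
Proof.
move=> ic [e1 h1]; have e2 := leaves_graft s ic.
split=> [|n u u' us us']; first by apply: succn_inj; rewrite !leaves_graft ?e1.
have en : leaves (graft c i s) = n by rewrite -us; apply/eqP: (valP u).
have e : (n.+1 = leaves c + leaves s)%N by rewrite -en e2.
pose cc := tree_at (erefl (leaves c)); pose ss := tree_at (erefl (leaves s)).
pose ss' := tree_at (esym e1).
have -> : u = so_comp_at e (Ordinal ic) cc ss by apply: val_inj; rewrite us.
have -> : u' = so_comp_at e (Ordinal ic) cc ss' by apply: val_inj; rewrite us'.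
rewrite -!lin_compU -[X in In X](linear_funB (op_compDr e (Ordinal ic) (basis cc : free _))).
by apply: ideal_compr; apply: h1.
Qed.

Lemma tree_eqv_graftl s i (c c' : tree) : (i < leaves c)%N ->
  tree_eqv c c' -> tree_eqv (graft c i s) (graft c' i s).
Proof.
move=> ic [e1 h1]; have ic' : (i < leaves c')%N by rewrite -e1.
have e2 := leaves_graft s ic.
split=> [|n u u' us us']; first by apply: succn_inj; rewrite !leaves_graft ?e1.
have en : leaves (graft c i s) = n by rewrite -us; apply/eqP: (valP u).
have e : (n.+1 = leaves c + leaves s)%N by rewrite -en e2.
pose cc := tree_at (erefl (leaves c)); pose ss := tree_at (erefl (leaves s)).
pose cc' := tree_at (esym e1).
have -> : u = so_comp_at e (Ordinal ic) cc ss by apply: val_inj; rewrite us.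
have -> : u' = so_comp_at e (Ordinal ic) cc' ss by apply: val_inj; rewrite us'.
rewrite -!lin_compU -[X in In X](linear_funB (op_compDl e (Ordinal ic) (basis ss : free _))).
by apply: ideal_compl; apply: h1.
Qed.

Lemma tree_eqv_Nd g l l' r r' :
  tree_eqv l l' -> tree_eqv r r' -> tree_eqv (Nd g l r) (Nd g l' r').
Proof.
move=> ll' rr'.
apply: (@tree_eqv_trans (Nd g l' r)).
  by apply: (@tree_eqv_graftr (Nd g leaf r) 0).
have := @tree_eqv_graftr (Nd g l' leaf) (leaves l') r r'.
by rewrite /= ltnn addn1 ltnSn; apply.
Qed.

Lemma tree_eqv_rel a b x y z (i : 'I_2) :
  tree_eqv (if i == 0 then Nd a (Nd b x y) z else Nd a x (Nd b y z))
    (Nd (lmax a b) x (Nd (lmax a b) y z)).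
Proof.
have H : tree_eqv (if i == 0 then Nd a (Nd b leaf leaf) leaf else Nd a leaf (Nd b leaf leaf))
    (Nd (lmax a b) leaf (Nd (lmax a b) leaf leaf)).
  split=> [|n u u' us us']; first by case: ifP.
  have en : n = 3%N by have /eqP <- := valP u'; rewrite us'.
  subst n.
  have -> : u = so_comp_at (erefl : 4 = 2 + 2)%N i (node_tree a) (node_tree b).
    apply: val_inj; rewrite us /=; case: i {us} => [[|[|//]] ?] //=.
  have -> : u' = so_comp_at (erefl : 4 = 2 + 2)%N (lift ord0 ord0)
      (node_tree (lmax a b)) (node_tree (lmax a b)).
    by apply: val_inj; rewrite us'.
  rewrite -!lin_compU; apply: ideal_rel; apply: InArity3.
  by exists a, b, i.
(* The relation is known on trees with three leaves; [z], [y] and [x] are grafted from right to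
   left, so that the positions of the remaining leaves do not change. *)
have := tree_eqv_graftl z (i := 2) _ H; case: eqP => [i0|i1] /(_ isT) {}H.
  have {}H := tree_eqv_graftl y (i := 1) _ H; have {}H := tree_eqv_graftl x (i := 0) _ (H isT).
  exact: H.
have {}H := tree_eqv_graftl y (i := 1) _ H; have {}H := tree_eqv_graftl x (i := 0) _ (H isT).
exact: H.
Qed.

Lemma tree_eqv_rot a b x y z :
  tree_eqv (Nd a (Nd b x y) z) (Nd (lmax a b) x (Nd (lmax a b) y z)).
Proof. exact: (tree_eqv_rel a b x y z 0). Qed.

Lemma tree_eqv_max a b x y z :
  tree_eqv (Nd a x (Nd b y z)) (Nd (lmax a b) x (Nd (lmax a b) y z)).
Proof. exact: (tree_eqv_rel a b x y z 1). Qed.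

(** The top label is absorbed one node at a time: [tree_eqv_max] raises the first two labels to
    their maximum, and the raised second label then acts on the rest of the comb. *)
Lemma tree_eqv_leaf_comb a c :
  tree_eqv (Nd a leaf (corolla_comb c)) (corolla_comb (corolla_star (CNode a 0) c)).
Proof.
case: c => [|b m]; first exact: tree_eqv_refl.
rewrite /corolla_star /= add0n; elim: m a b => [|m IH] a b.
  exact: tree_eqv_max.
apply: tree_eqv_trans (tree_eqv_max _ _ _ _ _) _.
apply: tree_eqv_Nd; first exact: tree_eqv_refl.
by apply: tree_eqv_trans (IH _ _) _; rewrite /lmax -maxA maxxx; apply: tree_eqv_refl.
Qed.

(** Induction on the left comb: a rotation moves its root to the right spine, and the shorter comb
    that remains is combined with the right child by the induction hypothesis. *)
Lemma tree_eqv_Nd_comb a c d :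
  tree_eqv (Nd a (corolla_comb c) (corolla_comb d))
    (corolla_comb (corolla_star (CNode a 0) (corolla_star c d))).
Proof.
case: c => [|b k]; first exact: tree_eqv_leaf_comb.
elim: k a b => [|k IH] a b.
  apply: tree_eqv_trans (tree_eqv_rot _ _ _ _ _) _.
  apply: tree_eqv_trans (tree_eqv_Nd _ (tree_eqv_refl _) (tree_eqv_leaf_comb _ _)) _.
  apply: tree_eqv_trans (tree_eqv_leaf_comb _ _) _; rewrite !corolla_starA.
  by rewrite /corolla_star /= /lmax maxxx; apply: tree_eqv_refl.
apply: tree_eqv_trans (tree_eqv_rot _ _ _ _ _) _.
apply: tree_eqv_trans (tree_eqv_Nd _ (tree_eqv_refl _) (IH _ _)) _.
apply: tree_eqv_trans (tree_eqv_leaf_comb _ _) _; rewrite !corolla_starA.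
have -> : corolla_star (corolla_star (CNode (lmax a b) 0) (CNode (lmax a b) 0)) (CNode b k)
    = corolla_star (CNode a 0) (CNode b k.+1).
  by rewrite /corolla_star /= /lmax maxxx -maxA maxxx.
exact: tree_eqv_refl.
Qed.

Lemma tree_eqv_corolla s : tree_eqv s (corolla_comb (tree_corolla s)).
Proof.
elim: s => [[]|g l IHl r IHr] /=; first exact: tree_eqv_refl.
exact: tree_eqv_trans (tree_eqv_Nd _ IHl IHr) (tree_eqv_Nd_comb _ _ _).
Qed.

Lemma qproj_comb n (u : so_at F n) :
  qproj (@As_rel K gamma) (basis u : free n) =
  qproj (@As_rel K gamma) (basis (corolla_comb_at (tree_corolla_at u)) : free n).
Proof. by apply/quot_piP/span_sub; apply: (tree_eqv_corolla (val u)).2. Qed.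

End TreeCongruence.

(** * The isomorphism with the operad of corollas *)

Section AsIso.
Variables (K : fieldType) (gamma : nat).
Local Notation free := (free_operad 'I_gamma K).
Local Notation F := (free_set_operad 'I_gamma).
Local Notation C := (corolla_set_operad gamma).
Local Notation R := (@As_rel K gamma).

Definition corolla_As n : corolla_operad K gamma n -> As K gamma n :=
  mlift (fun c : so_at C n => qproj R (basis (corolla_comb_at c) : free n)).

Lemma corolla_As_is_linear n : linear (@corolla_As n).
Proof. exact: mlift_is_linear. Qed.

Lemma qproj_is_linear n : linear (@qproj K 'I_gamma R n).
Proof. exact: quot_pi_is_linear. Qed.

Lemma As_ind n (Q : As K gamma n -> Prop) :
  (forall x : free n, Q (qproj R x)) -> forall x, Q x.
Proof. exact: quot_ind. Qed.

(** Injectivity of [As_corolla], which rests on the congruence of every tree with a comb. The other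
    composite only uses that a comb has the expected corolla. *)
Lemma As_corollaK n : cancel (@As_corolla K gamma n) (@corolla_As n).
Proof.
apply: As_ind => x; rewrite As_corollaE; move: x.
apply: linear_ext => [a u v|a u v|t].
- by rewrite (free_corolla_is_linear a u v) corolla_As_is_linear.
- exact: qproj_is_linear.
by rewrite (free_corollaU K t) [LHS]mlift_basis; apply/esym/qproj_comb.
Qed.

Lemma corolla_AsK n : cancel (@corolla_As n) (@As_corolla K gamma n).
Proof.
apply: linear_ext => [a u v|a u v //|t].
  by rewrite corolla_As_is_linear As_corolla_is_linear.
have -> : corolla_As (basis t) = qproj R (basis (corolla_comb_at t) : free n).
  exact: mlift_basis.
by rewrite As_corollaE (free_corollaU K (corolla_comb_at t)) corolla_comb_atK.
Qed.

Lemma As_corolla_one : @As_corolla K gamma 1 (op_one (As K gamma)) =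
  op_one (corolla_operad K gamma).
Proof. rewrite [LHS]As_corollaE; etransitivity; first exact: free_corollaU.
by congr basis; apply: val_inj. Qed.

Lemma As_corolla_comp n m p (e : (p.+1 = n + m)%N) (i : 'I_n) x y :
  @As_corolla K gamma p (op_comp (As K gamma) e i x y) =
  op_comp (corolla_operad K gamma) e i (As_corolla x) (As_corolla y).
Proof.
elim/As_ind: x => x; elim/As_ind: y => y.
by rewrite [op_comp _ _ _ _ _]qop_compE [LHS]As_corollaE !As_corollaE free_corolla_comp.
Qed.

Theorem As_operad_iso : operad_iso (As K gamma) (corolla_operad K gamma).
Proof.
exists (fun n => @As_corolla K gamma n); split.
- by move=> n; exists (@corolla_As n); [apply: As_corollaK | apply: corolla_AsK].
- exact: As_corolla_one.
- exact: As_corolla_comp.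
Qed.

End AsIso.

(** * The path order *)

Section SeqLexi.
Variables (disp : Order.disp_t) (T : orderType disp).
Implicit Types s t u v : seqlexi T.

Lemma ltxi_cat s t u v : size s = size t -> (s < t)%O -> (s ++ u < t ++ v :> seqlexi T)%O.
Proof.
elim: s t => [|x s IH] [|y t] //= [st].
rewrite !ltxi_cons => /andP[-> /=]; case: (y <= x)%O => //=.
exact: IH.
Qed.

Lemma lexi_cat2l s u v : (s ++ u <= s ++ v :> seqlexi T)%O = (u <= v)%O.
Proof. by elim: s => //= x s IH; rewrite eqhead_lexiE. Qed.

Lemma ltxi_cat2l s u v : (s ++ u < s ++ v :> seqlexi T)%O = (u < v)%O.
Proof. by elim: s => //= x s IH; rewrite eqhead_ltxiE. Qed.

End SeqLexi.

Section TreeOrder.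
Variable gamma : nat.
Local Notation tree := (syntax_tree 'I_gamma).
Implicit Types (t s u : tree) (p q : seq nat).

(** The path sequence of [t]: for each leaf, from left to right, the word of the labels met from the
    root, after the prefix [p]. *)
Fixpoint leaf_words p t : seq (seq nat) :=
  if t is Nd g l r then leaf_words (rcons p g) l ++ leaf_words (rcons p g) r
  else [:: p].

(* Longer words are smaller, words of the same length are compared lexicographically. *)
Definition word_key p : seqlexi int := - (size p)%:Z :: [seq n%:Z | n <- p].

Definition tree_key p t : seqlexi (seqlexi int) := map word_key (leaf_words p t).

Definition tree_le : rel tree := fun s t => (tree_key [::] s <= tree_key [::] t)%O.

Lemma word_key_inj : injective word_key.
Proof. by move=> p q [_]; apply: inj_map => m n []. Qed.

Lemma word_key_lt p q : (word_key p < word_key q)%O =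
  (size q < size p)%N || ((size p == size q) &&
    ([seq n%:Z | n <- p] < [seq n%:Z | n <- q] :> seqlexi int)%O).
Proof.
rewrite /word_key ltxi_cons; case: (ltngtP (size p) (size q)) => [lt|lt|e] /=.
- by apply/negbTE; rewrite negb_and -!ltNge; apply/orP; left; lia.
- by apply/andP; split; [lia | apply/implyP; lia].
- by rewrite e lexx.
Qed.

(** Lengths add up under concatenation, and for equal lengths the lexicographic comparison is
    decided by the first blocks. *)
Lemma word_key_cat_lt p p' q q' : (word_key p < word_key p')%O ->
  (word_key q <= word_key q')%O -> (word_key (p ++ q) < word_key (p' ++ q'))%O.
Proof.
rewrite [(word_key q <= _)%O]le_eqVlt !word_key_lt !size_cat !map_cat =>
  pp' /orP[/eqP/word_key_inj <-{q'}|qq'].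
  case/orP: pp' => [lt|/andP[/eqP e lt]]; first by rewrite ltn_add2r lt.
  by rewrite e eqxx /= ltxi_cat ?orbT // !size_map.
case/orP: pp' => [lt|/andP[/eqP e lt]].
  by case/orP: qq' => [lt'|/andP[/eqP e' _]]; apply/orP; left; lia.
rewrite e ltn_add2l eqn_add2l; case/orP: qq' => [->//|/andP[-> _]].
by rewrite ltxi_cat ?orbT // !size_map.
Qed.

Lemma word_key_cat_mono p q q' :
  (word_key (p ++ q) <= word_key (p ++ q'))%O = (word_key q <= word_key q')%O.
Proof.
rewrite ![(_ <= _)%O]leNgt !word_key_lt !size_cat !map_cat ltn_add2l eqn_add2l.
by rewrite ltxi_cat2l.
Qed.

Lemma leaf_words_cat p t : leaf_words p t = map (cat p) (leaf_words [::] t).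
Proof.
suff H q : leaf_words (p ++ q) t = map (cat p) (leaf_words q t) by rewrite -H cats0.
by elim: t q => //= g l IHl r IHr q; rewrite map_cat rcons_cat IHl IHr.
Qed.

Lemma size_leaf_words p t : size (leaf_words p t) = leaves t.
Proof. by elim: t p => //= g l IHl r IHr p; rewrite size_cat IHl IHr. Qed.

(** Grafting only changes the word [w] of the chosen leaf, which becomes the prefix of the words of
    [s]. [A], [w] and [B] come before [s], so that [t] and all its grafts share them. *)
Lemma leaf_words_graft p t i : (i < leaves t)%N ->
  exists A w B, [/\ size A = i, leaf_words p t = A ++ w :: B
    & forall s, leaf_words p (graft t i s) = A ++ leaf_words w s ++ B].
Proof.
elim: t p i => /= [_ p i|g l IHl r IHr p i it].
  rewrite ltnS leqn0 => /eqP ->; exists [::], p, [::]; split=> // s.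
  by rewrite cats0.
case: ltnP => il.
  have [A [w [B [sA -> E]]]] := IHl (rcons p g) i il.
  exists A, w, (B ++ leaf_words (rcons p g) r); split=> // [|s] /=.
    by rewrite -catA.
  by rewrite E -!catA.
have [|A [w [B [sA -> E]]]] := IHr (rcons p g) (i - leaves l)%N; first by rewrite ltn_subLR.
exists (leaf_words (rcons p g) l ++ A), w, B; split=> [||s] /=; last by rewrite E -!catA.
  by rewrite size_cat size_leaf_words sA subnKC.
by rewrite -catA.
Qed.

Lemma leaf_words_Nd p g l r : exists w W,
  leaf_words p (Nd g l r : tree) = (rcons p g ++ w) :: W.
Proof.
elim: l p g r => [[]|h l1 IH l2 _] p g r.
  by exists [::], (leaf_words (rcons p g) r); rewrite cats0.
have [w [W /= ->]] := IH (rcons p g) h l2.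
by exists ((h : nat) :: w), (W ++ leaf_words (rcons p g) r); rewrite /= -cat_rcons.
Qed.

(** Under the prefix [p], a leaf produces [p] itself and the first word of a node is longer, so this
    word tells them apart and gives the root label. The tails [X] and [X'] let the induction peel
    off the left child. *)
Lemma leaf_words_inj p t t' X X' :
  leaf_words p t ++ X = leaf_words p t' ++ X' -> t = t' /\ X = X'.
Proof.
elim: t p t' X X' => [[]|g l IHl r IHr] p [[]|g' l' r'] X X' E.
- by case: E.
- have [w [W E']] := leaf_words_Nd p g' l' r'; move: E; rewrite E' => -[/(congr1 size)].
  by rewrite size_cat size_rcons; lia.
- have [w [W E']] := leaf_words_Nd p g l r; move: E; rewrite E' => -[/(congr1 size)].
  by rewrite size_cat size_rcons; lia.
have [w [W E1]] := leaf_words_Nd p g l r; have [w' [W' E2]] := leaf_words_Nd p g' l' r'.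
have gg' : g = g'.
  move: E; rewrite E1 E2 => -[+ _]; rewrite -!cats1 -!catA => /eqP.
  by rewrite eqseq_cat // => /andP[_ /eqP[/val_inj]].
subst g'; move: E => /=; rewrite -!catA => /IHl[-> /IHr[-> ->]].
by [].
Qed.

(** The comparison is decided before the grafted leaf, or by the word of this leaf, or, when these
    agree, by the words of the grafted trees under a common prefix. *)
Lemma tree_le_graft s s' t t' i : leaves s = leaves s' -> leaves t = leaves t' ->
  (i < leaves s)%N -> tree_le s s' -> tree_le t t' -> tree_le (graft s i t) (graft s' i t').
Proof.
move=> ss' tt' it; have it' : (i < leaves s')%N by rewrite -ss'.
rewrite /tree_le /tree_key.
have [A [w [B [sA -> ->]]]] := leaf_words_graft [::] it.
have [A' [w' [B' [sA' -> ->]]]] := leaf_words_graft [::] it'.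
rewrite !map_cat /=; have sAA : size (map word_key A) = size (map word_key A').
  by rewrite !size_map sA sA'.
case: (ltgtP (map word_key A : seqlexi (seqlexi int)) (map word_key A')) =>
  [lt _ _|lt|<- {sAA}].
- by rewrite ltW // ltxi_cat.
- by rewrite leNgt ltxi_cat.
rewrite !lexi_cat2l lexi_cons => /andP[le_w].
have tk x : map word_key (leaf_words x t) = map (word_key \o cat x) (leaf_words [::] t).
  by rewrite leaf_words_cat -map_comp.
have tk' x : map word_key (leaf_words x t') = map (word_key \o cat x) (leaf_words [::] t').
  by rewrite leaf_words_cat -map_comp.
rewrite (tk w) (tk' w').
have : size (leaf_words [::] t) = size (leaf_words [::] t') by rewrite !size_leaf_words.
have [w0|nw0] := boolP (word_key w' <= word_key w)%O.
  have /word_key_inj <- : word_key w = word_key w' by apply/eqP; rewrite eq_le le_w.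
  move=> st BB' le_t.
  have le2 (X Y : seq (seq nat)) : size X = size Y ->
      (map word_key X <= map word_key Y :> seqlexi (seqlexi int))%O ->
      (map (word_key \o cat w) X ++ map word_key B
        <= map (word_key \o cat w) Y ++ map word_key B' :> seqlexi (seqlexi int))%O.
    elim: X Y => [|x X IH] [|y Y] //= [sXY]; rewrite lexi_cons => /andP[xy XY].
    rewrite lexi_cons /= !word_key_cat_mono xy /=; apply/implyP=> yx; apply: IH => //.
    by move/implyP: XY; apply.
  exact: le2.
move=> st _; have : leaf_words [::] t != [::] by rewrite -size_eq0 size_leaf_words -lt0n leaves_gt0.
case: (leaf_words [::] t) (leaf_words [::] t') st => [|x X] [|y Y] // _ _ /=.
rewrite lexi_cons => /andP[xy _]; rewrite lexi_cons /=.
have lt := word_key_cat_lt (_ : word_key w < word_key w')%O xy.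
have {}lt := lt (etrans (ltNge _ _) nw0).
by rewrite ltW //= leNgt lt.
Qed.

Lemma tree_le_order : tree_order tree_le.
Proof.
split=> [t|s t|t s u|s t|].
- exact: lexx.
- by move/le_anti => /(inj_map word_key_inj);
  rewrite -[X in X = _]cats0 -[X in _ = X]cats0 => /leaf_words_inj[].
- exact: le_trans.
- exact: le_total.
- exact: tree_le_graft.
Qed.

(** The first leaf of a comb has the shortest possible word, so a tree whose left child is not a
    leaf is smaller at its first word already. Otherwise the root labels are compared, then the
    right children. *)
Lemma tree_le_comb t (a : 'I_gamma) k : all (fun b : 'I_gamma => b <= a)%N (labels t) ->
  leaves t = k.+2 -> tree_le t (comb a k).
Proof.
(* The right child of a comb may be a leaf, hence a corolla [c] in place of [comb a k]; children are
   compared under the path [p] that leads to them. *)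
suff H p c : all (fun b : 'I_gamma => b <= a)%N (labels t) -> leaves t = corolla_ar c ->
    (if c is CNode b _ then b == a else true) ->
      (tree_key p t <= tree_key p (corolla_comb c))%O.
  by move=> ta tk; apply: (H [::] (CNode a k)) => //=.
elim: t p c => [[]|g l _ r IHr] p c /=; first by case: c.
rewrite all_cat => /and3P[ga la ra]; case: c => [|b m] /=.
  have l0 : (0 < leaves l)%N := leaves_gt0 l; have r0 : (0 < leaves r)%N := leaves_gt0 r.
  by lia.
move=> e /eqP ->.
have -> : tree_key p (comb a m) = word_key (rcons p a) :: tree_key (rcons p a)
   (corolla_comb (if m is m'.+1 then CNode a m' else CLeaf gamma)) by case: m {e}.
have -> : tree_key p (Nd g l r) = tree_key (rcons p g) l ++ tree_key (rcons p g) r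
  by rewrite /tree_key map_cat.
case: l la e => [[]|h l1 l2] la e.
  rewrite {1}/tree_key /=; move: ga; rewrite leq_eqVlt => /orP[/eqP ga|ga].
    rewrite ga eqhead_lexiE; apply: IHr => //; last by case: m {e}.
    by case: m e => [|m] /=; lia.
  rewrite lexi_cons.
  have lt : (word_key (rcons p g) < word_key (rcons p a))%O.
    rewrite word_key_lt !size_rcons ltnn eqxx !map_rcons -!cats1 ltxi_cat2l ltxi_cons.
    by apply/andP; split; [lia | apply/implyP; lia].
  by rewrite ltW //= leNgt lt.
have [w [W ->]] : exists w W, tree_key (rcons p g) (Nd h l1 l2) =
  word_key (rcons (rcons p g) h ++ w) :: W.
  have [w [W E]] := leaf_words_Nd (rcons p g) h l1 l2.
  by exists w, (map word_key W); rewrite /tree_key E.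
rewrite lexi_cons.
have lt : (word_key (rcons (rcons p g) h ++ w) < word_key (rcons p a))%O.
  by rewrite word_key_lt size_cat !size_rcons; apply/orP; left; lia.
by rewrite ltW //= leNgt lt.
Qed.

End TreeOrder.

(** * The Poincaré-Birkhoff-Witt basis *)

Section CoefSum.
Variables (K : fieldType) (S : choiceType).

Lemma coef0 (s : S) : coef s (0 : fmod K S) = 0.
Proof. by rewrite -(scale0r (0 : fmod K S)) coefZ mul0r. Qed.

Lemma coef_sum (I : Type) (r : seq I) (P : pred I) (f : I -> fmod K S) s :
  coef s (\sum_(i <- r | P i) f i) = \sum_(i <- r | P i) coef s (f i).
Proof. exact: (big_morph (coef s) (coefD s) (coef0 s)). Qed.

End CoefSum.

Section PBW.
Variables (K : fieldType) (gamma : nat).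
Local Notation tree := (syntax_tree 'I_gamma).
Local Notation free := (free_operad 'I_gamma K).
Local Notation F := (free_set_operad 'I_gamma).
Local Notation C := (corolla_set_operad gamma).
Local Notation R := (@As_rel K gamma).
Local Notation B := (@monochrome_right_comb gamma).
Implicit Types (t s u : tree) (a b : 'I_gamma).

Lemma constant_cons (T : eqType) (x : T) (s : seq T) : constant (x :: s) = all (pred1 x) s.
Proof. by []. Qed.

Lemma monochrome_corolla_comb (c : corolla gamma) : B (corolla_comb c).
Proof.
case: c => // a k; rewrite /monochrome_right_comb.
have [-> lab] : right_comb (comb a k) /\ labels (comb a k) = nseq k.+1 a.
  by elim: k => //= k [-> ->].
by rewrite lab /= all_nseq /= eqxx orbT.
Qed.

Lemma monochrome_comb a t : right_comb t -> all (pred1 a) (labels t) ->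
  t = if leaves t is n.+2 then comb a n else leaf.
Proof.
elim: t => [[]|g l _ r IHr] //=; case: l => [[]|//] rr /= /andP[/eqP -> ra].
have r0 : (0 < leaves r)%N := leaves_gt0 r.
by rewrite {1}(IHr rr ra); case: (leaves r) r0 => [|[|n]].
Qed.

Lemma monochromeP t : B t -> corolla_comb (tree_corolla t) = t.
Proof.
suff H : B t -> exists c, t = corolla_comb c.
  by case/H=> c ->; rewrite tree_corolla_comb.
case/andP=> rt; case: t rt => [[]|g l r] rt; first by exists (CLeaf gamma).
rewrite constant_cons => lt; have := @monochrome_comb g _ rt; rewrite /= eqxx => /(_ lt) ->.
case: (_ + _)%N => [|[|n]]; [exists (CLeaf gamma)|exists (CLeaf gamma)|exists (CNode g n)] =>
  //.
Qed.

Lemma labels_tree_corolla t :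
  if tree_corolla t is CNode a _ then all (fun b : 'I_gamma => b <= a)%N (labels t)
  else labels t = [::].
Proof.
have le a b c : (c <= a)%N || (c <= b)%N -> (c <= lmax a b)%N.
  by rewrite /lmax /Order.max ltEord; case: ltnP => ? /orP[]; lia.
have le_all m a (s : seq _) : (a <= m)%N -> all (fun b : 'I_gamma => b <= a)%N s ->
    all (fun b : 'I_gamma => b <= m)%N s.
  by move=> am; apply: sub_all => x xa; apply: leq_trans am.
elim: t => //= g l IHl r IHr; rewrite /corolla_star.
case: (tree_corolla l) IHl => [->|a k la]; case: (tree_corolla r) IHr => [->|b m rb] /=.
- by rewrite leqnn.
- by rewrite le ?leqnn //=; apply: le_all rb; rewrite le // leqnn orbT.
- by rewrite cats0 le ?leqnn //=; apply: le_all la; rewrite le // leqnn orbT.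
- rewrite all_cat le ?leqnn //=; apply/andP; split.
    by apply: le_all la; rewrite le // (@le a b) ?leqnn ?orbT.
  by apply: le_all rb; rewrite le // (@le a b) ?leqnn ?orbT.
Qed.

Lemma tree_le_corolla t : tree_le t (corolla_comb (tree_corolla t)).
Proof.
have := labels_tree_corolla t; have := tree_corolla_ar t.
case: (tree_corolla t) => [|a k] /= lt; last by move=> /tree_le_comb; apply.
by case: t lt => [[]|? ? ?] //= _ _; apply: lexx.
Qed.

Definition comb_expansion n : corolla_operad K gamma n -> free n :=
  mlift (fun c : so_at C n => (basis (corolla_comb_at c) : free n)).

Lemma comb_expansion_is_linear n : linear (@comb_expansion n).
Proof. exact: mlift_is_linear. Qed.

Lemma comb_expansionU n (c : so_at C n) :
  comb_expansion (basis c) = basis (corolla_comb_at c).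
Proof. exact: mlift_basis. Qed.

Lemma qproj_comb_expansion n (x : corolla_operad K gamma n) :
  qproj R (comb_expansion x) = corolla_As x.
Proof.
move: x; apply: linear_ext => [a u v|a u v|c].
- by rewrite comb_expansion_is_linear qproj_is_linear.
- exact: corolla_As_is_linear.
by rewrite (comb_expansionU c); apply/esym/mlift_basis.
Qed.

Lemma supp_comb_expansion n (x : corolla_operad K gamma n) :
  {in supp (comb_expansion x), forall v : so_at F n, B (val v)}.
Proof.
move=> t; rewrite supp_coef; apply: contraR => nB.
rewrite /comb_expansion mliftE coef_sum big1 //= => c _.
rewrite coefZ coef_basis; case: eqP => [E|_]; last by rewrite mulr0.
by rewrite -E monochrome_corolla_comb in nB.
Qed.

Lemma comb_expansionK n (c : free n) : {in supp c, forall v : so_at F n, B (val v)} ->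
  comb_expansion (free_corolla c) = c.
Proof.
move=> cB; rewrite [X in free_corolla X]fmodE [RHS]fmodE.
have /= : forall v : so_at F n, v \in enum_fset (supp c) -> B (val v) by exact: cB.
elim: (enum_fset _) => [|t r IH] rB.
  by rewrite !big_nil (linear_fun0 (@free_corolla_is_linear _ _ n))
    (linear_fun0 (@comb_expansion_is_linear n)).
rewrite !big_cons (free_corolla_is_linear (coef t c) (basis t)) comb_expansion_is_linear.
rewrite IH; last by move=> s sr; apply: rB; rewrite inE sr orbT.
have E : comb_expansion (free_corolla (basis t)) = basis t :> free n.
  rewrite (free_corollaU K t) comb_expansionU; congr basis.
  by apply: val_inj; rewrite /= monochromeP // rB // mem_head.
rewrite -> E.
reflexivity.
Qed.

(** A decomposition is determined by its image in the corollas, because [comb_expansion] after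
    [free_corolla] fixes the combinations of monochrome combs. *)
Lemma decompositionP n (y : As K gamma n) c :
  decomposition B y c <-> c = comb_expansion (As_corolla y).
Proof.
split=> [[cB <-]|->].
  by rewrite As_corollaE comb_expansionK.
split; first exact: supp_comb_expansion.
by rewrite qproj_comb_expansion As_corollaK.
Qed.

Lemma monochrome_edges t : B t = all B (edge_subtrees t).
Proof.
elim: t => [[]|g l IHl r IHr] //=; rewrite !all_cat -IHl -IHr.
case: l {IHl} => [[]|h l1 l2] //=; case: r {IHr} => [[]|h r1 r2] //=.
rewrite /monochrome_right_comb /= !andbT.
by case: (h =P g) => [->|]; rewrite ?andbF.
Qed.

Theorem As_PBW : PBW_basis R B.
Proof.
exists (@tree_le gamma); first exact: tree_le_order.
split=> [n y|s t i n u c _ _ _ _ nBu /decompositionP ->|].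
- exists (comb_expansion (As_corolla y)); split; first exact/decompositionP.
  by move=> c /decompositionP ->.
(* The decomposition of a tree is a single comb, that of its corolla; it differs from the tree,
   since it belongs to the basis and the tree does not. *)
- rewrite As_corollaE (free_corollaU K u) comb_expansionU => v.
  rewrite supp_coef coef_basis; case: (_ =P v) => [<- _|_]; last by rewrite eqxx.
  rewrite tree_le_corolla /=; apply: contra nBu => /eqP E.
  by rewrite -[val u]E; apply: monochrome_corolla_comb.
- exact: monochrome_edges.
Qed.

End PBW.

(** * The homotopy on decorated trees *)

Section SplitMerge.
Variables (K : fieldType) (gamma : nat).
Local Notation dtree := (btree 'I_gamma (corolla gamma)).
Local Notation unit_leaf := (Lf (CLeaf gamma) : dtree).
Implicit Types (t s l r : dtree) (u v : dtree -> K) (c d : 'I_gamma).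

(* The corolla of label c with k + 1 leaves, which is the unit for k = 0. *)
Definition corolla_of_ar c (k : nat) : corolla gamma :=
  if k is k'.+1 then CNode c k' else CLeaf gamma.

Lemma corolla_ar_of_ar c k : corolla_ar (corolla_of_ar c k) = k.+1.
Proof. by case: k. Qed.

Fixpoint total_ar t : nat :=
  match t with Lf q => corolla_ar q | Nd _ l r => total_ar l + total_ar r end.

(* The value of the functional u on D t, where D is the signed sum of the ways to
   split a leaf in two; the sign is given by the rank of the leaf. *)
Fixpoint splits t u : K :=
  match t with
  | Lf (CLeaf) => 0
  | Lf (CNode c k) =>
      \sum_(i < k.+1) u (Nd c (Lf (corolla_of_ar c i)) (Lf (corolla_of_ar c (k - i))))
  | Nd c l r =>
      splits l (fun l' => u (Nd c l' r))
      + (-1) ^+ leaves l * splits r (fun r' => u (Nd c l r'))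
  end.

(* t with a unit leaf merged by the product of label c to the left of its first
   leaf, when the path from the root to this leaf only meets the label c. *)
Fixpoint add_unit c t : option dtree :=
  match t with
  | Lf (CLeaf) => Some (Lf (CNode c 0))
  | Lf (CNode d k) => if d == c then Some (Lf (CNode c k.+1)) else None
  | Nd d l r => if d == c then omap (fun l' => Nd c l' r) (add_unit c l) else None
  end.

(* The value of u on S t.  At the first node whose left child is a unit, this unit is
   merged with the next leaf if, up to rotations, they are the two children of a node;
   otherwise S acts, with a sign, on the right child. *)
Fixpoint merges t u : K :=
  match t with
  | Lf _ => 0
  | Nd c l r =>
      if l is Lf (CLeaf) then
        if add_unit c r is Some r' then u r' else - merges r (fun r' => u (Nd c l r'))
      else merges l (fun l' => u (Nd c l' r))
  end.

Inductive rotation : dtree -> dtree -> Prop :=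
| rotation_root c x y z : rotation (Nd c (Nd c x y) z) (Nd c x (Nd c y z))
| rotation_l c l l' r : rotation l l' -> rotation (Nd c l r) (Nd c l' r)
| rotation_r c l r r' : rotation r r' -> rotation (Nd c l r) (Nd c l r').

Definition rotation_invariant u := forall t t', rotation t t' -> u t = u t'.

Lemma rotation_invariant_l u c r :
  rotation_invariant u -> rotation_invariant (fun l => u (Nd c l r)).
Proof. by move=> uI t t' tt'; apply: uI; constructor. Qed.

Lemma rotation_invariant_r u c l :
  rotation_invariant u -> rotation_invariant (fun r => u (Nd c l r)).
Proof. by move=> uI t t' tt'; apply: uI; constructor. Qed.

Lemma add_unit_leaves c t t' : add_unit c t = Some t' ->
  leaves t' = leaves t /\ total_ar t' = (total_ar t).+1.
Proof.
elim: t t' => [[|d k]|d l IHl r _] t' /=; first by case=> <-.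
  by case: eqP => // _ [<-].
case: eqP => // _; case: (add_unit c l) IHl => //= l' /(_ _ erefl)[el al] [<-] /=.
by rewrite el al addSn.
Qed.

(** A rotation can only remove one of two equal labels from the path to the first leaf, so the test
    made by [add_unit] has the same outcome. *)
Lemma add_unit_rotation c t t' : rotation t t' ->
  match add_unit c t, add_unit c t' with
  | Some s, Some s' => rotation s s'
  | None, None => True
  | _, _ => False
  end.
Proof.
elim=> {t t'} [d x y z|d l l' r _|d l r r' rr' _] /=.
- by case: eqP => //= ->; case: (add_unit c x) => //= x'; constructor.
- case: eqP => //= _; case: (add_unit c l) (add_unit c l') => [s|] [s'|] //= ?.
  by constructor.
- by case: eqP => //= _; case: (add_unit c l) => //= s; constructor.
Qed.

(** The hypotheses record what a splitting preserves. A leaf of label c splits below a node of label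
    c, so [add_unit] succeeds for the same labels before and after; the homotopy formula needs this
    to know which branch of [merges] is taken. *)
Lemma splits_ext t u v :
  (forall s, leaves s = (leaves t).+1 -> total_ar s = total_ar t -> s <> unit_leaf ->
     (forall c, isSome (add_unit c s) = isSome (add_unit c t)) -> u s = v s) ->
  splits t u = splits t v.
Proof.
elim: t u v => [[|c k]|c l IHl r IHr] u v uv //=.
  apply: eq_bigr => i _; have := ltn_ord i => ik; apply: uv => //= [|d].
    by rewrite !corolla_ar_of_ar; lia.
  case: (c =P d) => // ->; case: (val i) => [|j] /=; rewrite ?eqxx //.
congr (_ + _ * _); [apply: IHl|apply: IHr] => s ls ts _ cs; apply: uv => //=.
- by rewrite ls addSn.
- by rewrite ts.
- by move=> d; case: eqP => // <-; have := cs c;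
  case: (add_unit c s) (add_unit c l) => [?|] [?|].
- by rewrite ls addnS.
- by rewrite ts.
- by move=> d; case: eqP => // _; case: (add_unit d l).
Qed.

Lemma merges_ext t u v :
  (forall s, (leaves s).+1 = leaves t -> total_ar s = total_ar t -> u s = v s) ->
  merges t u = merges t v.
Proof.
elim: t u v => [//|c l IHl r IHr] u v uv /=.
have Hl : merges l (fun l' => u (Nd c l' r)) = merges l (fun l' => v (Nd c l' r)).
  by apply: IHl => s ls ts; apply: uv => /=; [rewrite -ls addSn | rewrite ts].
case: l uv Hl {IHl} => [[|//]|//] uv _.
case E: (add_unit c r) => [r'|].
  by have [lr tr] := add_unit_leaves E; apply: uv; rewrite /= ?lr ?tr.
by congr (- _); apply: IHr => s ls ts; apply: uv => /=; [rewrite -ls addnS | rewrite ts].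
Qed.

Lemma merges_eq t u v : u =1 v -> merges t u = merges t v.
Proof. by move=> uv; apply: merges_ext => s _ _. Qed.

Lemma splits_eq t u v : u =1 v -> splits t u = splits t v.
Proof. by move=> uv; apply: splits_ext => s _ _ _ _. Qed.

Lemma merges0 t : merges t (fun=> 0) = 0.
Proof.
elim: t => [//|c l IHl r IHr] /=; rewrite IHl IHr oppr0.
by case: l {IHl} => [[|? ?]|? ? ?] //; case: (add_unit c r).
Qed.

Lemma mergesD t u v : merges t (fun s => u s + v s) = merges t u + merges t v.
Proof.
elim: t u v => [|c l IHl r IHr] u v /=; first by rewrite addr0.
rewrite IHl; case: l {IHl} => [[|? ?]|? ? ?] //; case: (add_unit c r) => // .
by rewrite IHr opprD.
Qed.

Lemma mergesZ t a u : merges t (fun s => a * u s) = a * merges t u.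
Proof.
elim: t u => [|c l IHl r IHr] u /=; first by rewrite mulr0.
rewrite IHl; case: l {IHl} => [[|? ?]|? ? ?] //; case: (add_unit c r) => //.
by rewrite IHr mulrN.
Qed.

Lemma merges_sum t (I : Type) (q : seq I) (f : I -> dtree -> K) :
  merges t (fun s => \sum_(i <- q) f i s) = \sum_(i <- q) merges t (f i).
Proof.
elim: q => [|i q IH].
  by rewrite big_nil -[RHS](merges0 t); apply: merges_eq => s; rewrite big_nil.
rewrite big_cons -IH -mergesD; apply: merges_eq => s; rewrite big_cons //.
Qed.

Lemma splitsZ t a u : splits t (fun s => a * u s) = a * splits t u.
Proof.
elim: t u => [[|c k]|c l IHl r IHr] u /=; first by rewrite mulr0.
  by rewrite mulr_sumr.
by rewrite IHl IHr mulrDr mulrCA.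
Qed.

Lemma splits_mergesC t s (w : dtree -> dtree -> K) :
  splits t (fun t' => merges s (fun s' => w s' t'))
  = merges s (fun s' => splits t (w s')).
Proof.
elim: t w => [[|c k]|c l IHl r IHr] w /=; first by rewrite merges0.
  by rewrite merges_sum.
by rewrite mergesD mergesZ -IHl -IHr.
Qed.

Lemma merges_rotation u : rotation_invariant u -> rotation_invariant (merges^~ u).
Proof.
move=> + t t' tt'; elim: tt' u => {t t'} [c x y z|c l l' r ll' IH|c l r r' rr' IH] u uI /=.
- case: x => [[|d k]|d x1 x2].
  (* Here [x] is a unit. In the rotated tree, [add_unit] goes through the inner node and reaches
     [y]; if it fails there, [y] is not a unit and both sides merge inside [y]. *)
  + rewrite eqxx; case Ey: (add_unit c y) => [y'|] //=.
    case: y Ey => [[|? ?]|? ? ?] Ey; [by [] | | ]; congr (- _).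
    by apply: merges_eq => s; apply: uI; constructor.
  + by rewrite /=.
  + by apply: merges_eq => s; apply: uI; constructor.
- rewrite (IH _ (rotation_invariant_l _ _ uI)).
  by case: l l' ll' {IH} => [?|? ? ?] [?|? ? ?] //= ll'; inversion ll'.
- rewrite (IH _ (rotation_invariant_r _ _ uI)).
  have H : merges l (fun l' => u (Nd c l' r)) = merges l (fun l' => u (Nd c l' r')).
    by apply: merges_eq => s; apply: uI; constructor.
  case: l H => [[|? ?]|? ? ?] // _.
  have := add_unit_rotation c rr'.
  by case: (add_unit c r) (add_unit c r') => [s|] [s'|] // /uI.
Qed.

Lemma splits_Nd c l r u : splits (Nd c l r) u =
  splits l (fun l' => u (Nd c l' r)) + (-1) ^+ leaves l * splits r (fun r' => u (Nd c l r')).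
Proof. by []. Qed.

(** Splitting the enlarged first leaf of [r0] into a unit and the rest gives, up to rotations,
    [Nd c unit_leaf r]. Every other splitting of [r0] is a splitting of [r] followed by the merging
    of the unit. *)
Lemma splits_add_unit c r r0 u : add_unit c r = Some r0 -> rotation_invariant u ->
  splits r0 u - splits r (fun r' => merges (Nd c unit_leaf r') u) = u (Nd c unit_leaf r).
Proof.
elim: r r0 u => [[|d k]|d r1 IH r2 _] r0 u.
- by case=> <- _ /=; rewrite big_ord_recl big_ord0 subr0 addr0.
- rewrite /=; case: eqP => // -> [<-] _ /=; rewrite big_ord_recl /=.
  rewrite -[RHS]addr0 -addrA; congr (_ + _); apply/eqP; rewrite subr_eq0; apply/eqP.
  apply: eq_bigr => i _; rewrite /bump leq0n add1n subSS.
  by case: (val i) => [|j] //=; rewrite eqxx.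
rewrite [add_unit _ _]/=; case: eqP => // ->; case E: (add_unit c r1) => [r1'|] // [<-] uI.
rewrite !splits_Nd.
have [-> _] := add_unit_leaves E.
have := IH _ (fun t => u (Nd c t r2)) E (rotation_invariant_l _ _ uI).
(* Up to a rotation the unit is a sibling of [r1], as in the induction hypothesis. *)
rewrite -(uI _ _ (rotation_root _ _ _ _)) => <-.
have -> : splits r1 (fun s => merges (Nd c unit_leaf (Nd c s r2)) u) =
    splits r1 (fun s => merges (Nd c unit_leaf s) (fun t => u (Nd c t r2))).
  apply: splits_ext => s _ _ _ /(_ c); rewrite E /= eqxx.
  by case: (add_unit c s).
have -> : splits r2 (fun s => merges (Nd c unit_leaf (Nd c r1 s)) u) =
    splits r2 (fun s => u (Nd c r1' s)).
  by apply: splits_eq => s; rewrite /= eqxx E.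
by rewrite opprD addrACA subrr addr0.
Qed.

Lemma splits_merges t u : t <> unit_leaf -> rotation_invariant u ->
  splits t (fun s => merges s u) + merges t (fun s => splits s u) = u t.
Proof.
elim: t u => [[|c k]|c l IHl r IHr] u // t1 uI.
  (* On a leaf, only the splitting whose left part is a unit contributes, and the merging undoes
     it. *)
  rewrite /= addr0 big_ord_recl big1 => [|i _] //=.
  rewrite subn0 addr0; case: k {t1} => [|k] //=; rewrite eqxx //.
have [l1|l1] := pselect (l = unit_leaf).
  subst l; case E: (add_unit c r) => [r'|].
    by rewrite -(splits_add_unit E uI) /= E add0r expr1 mulN1r addrC.
  have r1 : r <> unit_leaf by move=> r1; rewrite r1 in E.
  rewrite -(IHr _ r1 (rotation_invariant_r c unit_leaf uI)) /= E add0r expr1 mulN1r.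
  congr (_ + _); last first.
    by rewrite -[LHS]mulN1r -mergesZ; apply: merges_eq => s /=; rewrite add0r !mulN1r opprK.
  rewrite -[LHS]mulN1r -splitsZ; apply: splits_ext => s _ _ _ /(_ c); rewrite E /=.
  by case: (add_unit c s) => //= _; rewrite mulN1r opprK.
have mE (w : dtree -> K) x y : x <> unit_leaf -> merges (Nd c x y) w = merges x (fun s =>
  w (Nd c s y)).
  by case: x => [[]|].
rewrite mE //= -(IHl _ l1 (rotation_invariant_l c r uI)).
have -> : splits l (fun l' => merges (Nd c l' r) u) = splits l (fun l' => merges l' (fun s =>
  u (Nd c s r))).
  by apply: splits_ext => s _ _ s1 _; rewrite mE.
have -> : splits r (fun r' => merges (Nd c l r') u) = splits r (fun r' => merges l (fun s =>
  u (Nd c s r'))).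
  by apply: splits_eq => s; rewrite mE.
(* [s] has one leaf fewer than [l]; this reverses the sign in front of the splittings of [r], and
   the cross terms cancel. *)
have -> : merges l (fun s => splits (Nd c s r) u) =
    merges l (fun s => splits s (fun s' => u (Nd c s' r))
       + (- (-1) ^+ leaves l) * splits r (fun r' => u (Nd c s r'))).
  by apply: merges_ext => s ls _ /=; rewrite -ls exprS mulN1r opprK.
by rewrite mergesD mergesZ splits_mergesC mulNr addrACA subrr addr0.
Qed.

End SplitMerge.

(** * Change of basis on the labels *)

Section LabelTransform.
Variables (K : fieldType) (gamma : nat).
Local Notation tree := (syntax_tree 'I_gamma).
Implicit Types (t s l r x y z : tree) (X Y : tree -> K) (A B : 'M[K]_gamma).

(* Multiplication by (-1) ^+ left_nodes t turns the signed rotations of the Koszul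
   dual into rotations, and the prefix signs of the differential into those of
   [splits]. *)
Fixpoint left_nodes (G S : Type) (t : btree G S) : nat :=
  if t is Nd _ l r then (left_nodes l + left_nodes r + nodes l)%N else 0.

Lemma nodes_leaves (G S : Type) (t : btree G S) : leaves t = (nodes t).+1.
Proof. by elim: t => //= _ l -> r ->; rewrite addSn addnS. Qed.

(** The rotation lowers [left_nodes] by [nodes x] plus one at this edge; it keeps the number of
    nodes, so nothing changes above. *)
Lemma left_nodes_rotation (c : tree) i a b x y z :
  (-1) ^+ left_nodes (graft c i (Nd a (Nd b x y) z)) =
  - (-1) ^+ nodes x * (-1) ^+ left_nodes (graft c i (Nd a x (Nd b y z))) :> K.
Proof.
have nE : forall (c : tree) i, nodes (graft c i (Nd a (Nd b x y) z)) =
  nodes (graft c i (Nd a x (Nd b y z))).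
  elim=> [[]|h l IHl r IHr] j /=; first by rewrite addSn addnS addnA.
  by case: ifP => _ /=; rewrite ?IHl ?IHr.
elim: c i => [[]|h l IHl r IHr] i /=.
  rewrite mulNr -exprD -[RHS]mulN1r -exprS; congr (_ ^+ _).
  by rewrite /=; lia.
case: ifP => _ /=; rewrite !exprD ?IHl ?IHr ?nE; ring.
Qed.

(** The multilinear extension of [X] to trees with vectors at their nodes, evaluated with row c of
    [A] at a node of label c. *)
Fixpoint relabel A t X : K :=
  if t is Nd c l r then
    \sum_a A c a * relabel A l (fun l' => relabel A r (fun r' => X (Nd a l' r')))
  else X leaf.

Lemma relabel_ext A t X Y :
  (forall s, nodes s = nodes t -> left_nodes s = left_nodes t -> X s = Y s) ->
  relabel A t X = relabel A t Y.
Proof.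
elim: t X Y => [[]|c l IHl r IHr] X Y XY /=; first exact: XY.
apply: eq_bigr => a _; congr (_ * _); apply: IHl => l' nl ll; apply: IHr => r' nr lr.
by apply: XY => /=; rewrite ?nl ?ll ?nr ?lr.
Qed.

Lemma eq_relabel A t X Y : X =1 Y -> relabel A t X = relabel A t Y.
Proof. by move=> XY; apply: relabel_ext. Qed.

Lemma relabelZ A t a X : relabel A t (fun s => a * X s) = a * relabel A t X.
Proof.
elim: t X => [[]|c l IHl r IHr] X //=; rewrite mulr_sumr; apply: eq_bigr => b _.
by rewrite mulrCA -IHl; congr (_ * _); apply: eq_relabel => l'; rewrite IHr.
Qed.

Lemma relabelD A t X Y : relabel A t (fun s => X s + Y s) = relabel A t X + relabel A t Y.
Proof.
elim: t X Y => [[]|c l IHl r IHr] X Y //=; rewrite -big_split; apply: eq_bigr => b _ /=.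
by rewrite -mulrDr -IHl; congr (_ * _); apply: eq_relabel => l'; rewrite IHr.
Qed.

Lemma relabel0 A t : relabel A t (fun=> 0) = 0.
Proof. by have := relabelZ A t 0 (fun=> 0); rewrite !mul0r. Qed.

Lemma relabel_sum A t (I : Type) (q : seq I) (f : I -> tree -> K) :
  relabel A t (fun s => \sum_(i <- q) f i s) = \sum_(i <- q) relabel A t (f i).
Proof.
elim: q => [|i q IH].
  by rewrite big_nil -[RHS](relabel0 A t); apply: eq_relabel => s; rewrite big_nil.
by rewrite big_cons -IH -relabelD; apply: eq_relabel => s; rewrite big_cons.
Qed.

Lemma relabelC A B t s (w : tree -> tree -> K) :
  relabel A t (fun t' => relabel B s (w t')) = relabel B s (fun s' => relabel A t (w^~ s')).
Proof.
elim: t w => [[]|c l IHl r IHr] w //=.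
rewrite relabel_sum; apply: eq_bigr => a _; rewrite relabelZ -IHl; congr (_ * _).
by apply: eq_relabel => l'; rewrite IHr.
Qed.

Lemma relabel_mul A B t X : relabel A t (fun s => relabel B s X) = relabel (A *m B) t X.
Proof.
elim: t X => [[]|c l IHl r IHr] X //=.
under eq_bigr => a _.
  under eq_relabel => l' do rewrite relabel_sum.
  rewrite relabel_sum mulr_sumr.
  under eq_bigr => b _.
    under eq_relabel => l'.
      rewrite relabelZ relabelC.
      under eq_relabel => l'' do rewrite IHr.
      over.
    rewrite relabelZ IHl mulrA.
    over.
  over.
rewrite exchange_big; apply: eq_bigr => b _ /=.
by rewrite -mulr_suml; congr (_ * _); rewrite mxE.
Qed.

Lemma relabel1 t X : relabel 1%:M t X = X t.
Proof.
elim: t X => [[]|c l IHl r IHr] X //=.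
rewrite (bigD1 c) //= mxE eqxx mul1r big1 ?addr0 => [|a ac].
  by rewrite IHl IHr.
by rewrite mxE eq_sym (negbTE ac) mul0r.
Qed.

Lemma relabel_graft A c i t X : (i < leaves c)%N ->
  relabel A (graft c i t) X = relabel A c (fun c' => relabel A t (fun t' => X (graft c' i t'))).
Proof.
elim: c i X => [[]|h l IHl r IHr] i X //= il.
case: ltnP => li /=; apply: eq_bigr => a _; congr (_ * _).
  rewrite IHl //; apply: relabel_ext => l' nl _; rewrite relabelC.
  by apply: eq_relabel => r'; apply: eq_relabel => t';
    rewrite /= nodes_leaves nl -nodes_leaves li.
apply: relabel_ext => l' nl _; rewrite IHr ?ltn_subLR //.
apply: eq_relabel => r'; apply: eq_relabel => t' /=.
have -> : leaves l' = leaves l by rewrite !nodes_leaves nl.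
by rewrite ltnNge li.
Qed.

(** Relabels everything around an edge; the labels of its two ends are summed apart. *)
Definition relabel_at A c x y z (X : tree -> tree -> tree -> tree -> K) : K :=
  relabel A c (fun c' => relabel A x (fun x' => relabel A y (fun y' => relabel A z (fun z' =>
    X c' x' y' z')))).

Lemma relabel_graft_left A c i a b x y z X : (i < leaves c)%N ->
  relabel A (graft c i (Nd a (Nd b x y) z)) X =
  \sum_d \sum_e A a d * A b e * relabel_at A c x y z
    (fun c' x' y' z' => X (graft c' i (Nd d (Nd e x' y') z'))).
Proof.
move=> ic; rewrite relabel_graft //= /relabel_at relabel_sum; apply: eq_bigr => d _.
rewrite relabelZ -[RHS]/(\sum_e _); under [RHS]eq_bigr => e _ do rewrite -mulrA.
by rewrite -mulr_sumr relabel_sum; congr (_ * _); apply: eq_bigr => e _; rewrite relabelZ.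
Qed.

Lemma relabel_graft_right A c i a b x y z X : (i < leaves c)%N ->
  relabel A (graft c i (Nd a x (Nd b y z))) X =
  \sum_d \sum_e A a d * A b e * relabel_at A c x y z
    (fun c' x' y' z' => X (graft c' i (Nd d x' (Nd e y' z')))).
Proof.
move=> ic; rewrite relabel_graft //= /relabel_at relabel_sum; apply: eq_bigr => d _.
rewrite relabelZ -[RHS]/(\sum_e _); under [RHS]eq_bigr => e _ do rewrite -mulrA.
rewrite -mulr_sumr; congr (_ * _).
under eq_relabel => c' do rewrite relabel_sum.
rewrite relabel_sum; apply: eq_bigr => e _; rewrite -relabelZ; apply: eq_relabel => c'.
by rewrite -relabelZ.
Qed.

End LabelTransform.

(** * Coordinates on the operad *)

Section Coordinates.
Variables (K : fieldType) (gamma : nat).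
Local Notation free := (free_operad 'I_gamma K).
Local Notation F := (free_set_operad 'I_gamma).
Local Notation C := (corolla_set_operad gamma).
Local Notation R := (@As_rel K gamma).
Local Notation P := (As K gamma).
Implicit Types (a b c : 'I_gamma) (q x y : corolla gamma).

(* The expansion of the generators e_g on the basis f: e_g is the sum of the f_c
   with g <= c. *)
Definition label_mx : 'M[K]_gamma := \matrix_(g, c) (g <= c)%N%:R.

Lemma label_mx_unit : label_mx \in unitmx.
Proof.
rewrite unitmxE -det_tr det_trig; last first.
  by apply/is_trig_mxP => i j ij; rewrite !mxE leqNgt ij.
by rewrite big1 ?unitr1 // => i _; rewrite !mxE leqnn.
Qed.

Lemma leq_lmax a b c : (lmax a b <= c)%N = (a <= c)%N && (b <= c)%N.
Proof. by rewrite /lmax /Order.max ltEord; case: ltnP => ab; apply/idP/andP; lia. Qed.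

Definition label_le x c : bool := if x is CNode a _ then (a <= c)%N else true.

(* corolla_le x q is the coordinate on q, in the basis f, of the corolla x. *)
Definition corolla_le x q : bool :=
  (corolla_ar x == corolla_ar q) && (if q is CNode c _ then label_le x c else true).

Lemma label_le_star x y c : label_le (corolla_star x y) c = label_le x c && label_le y c.
Proof. by case: x y => [|a k] [|b m] //=; rewrite ?andbT // leq_lmax. Qed.

Lemma corolla_ar_gt0 x : (0 < corolla_ar x)%N.
Proof. by case: x. Qed.

Lemma corolla_le_of_ar x c i :
  corolla_le x (corolla_of_ar c i) = (corolla_ar x == i.+1) && label_le x c.
Proof. by case: i x => [|i] [|a k]. Qed.

(** A bound on a maximum is a product of bounds, and at most one term of the sum is nonzero, the one
    selected by the arity of [x]. *)
Lemma corolla_le_star g x y c k :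
  (corolla_le (corolla_star (corolla_star (CNode g 0) y) x) (CNode c k))%:R =
  label_mx g c * \sum_(i < k.+1) (corolla_le x (corolla_of_ar c i))%:R
      * (corolla_le y (corolla_of_ar c (k - i)))%:R :> K.
Proof.
under eq_bigr => i _ do rewrite !corolla_le_of_ar -natrM mulnb.
rewrite mxE /corolla_le !label_le_star /=.
have arE : corolla_ar (corolla_star (corolla_star (CNode g 0) y) x) =
  (corolla_ar x + corolla_ar y)%N.
  have := @corolla_ar_star gamma (CNode g 0) 0 y isT.
  have := @corolla_ar_star gamma (corolla_star (CNode g 0) y) 0 x (corolla_ar_gt0 _).
  by rewrite /=; lia.
rewrite arE; have x0 := corolla_ar_gt0 x; have y0 := corolla_ar_gt0 y.
case: (g <= c)%N; last by rewrite mul0r andbF.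
rewrite mul1r; case: (label_le x c); last first.
  by rewrite !andbF big1 // => i _; rewrite !andbF.
case: (label_le y c); last by rewrite !andbF big1 // => i _; rewrite !andbF.
rewrite !andbT; under eq_bigr => i _ do rewrite !andbT.
case: eqP => [e|ne].
  have ik : ((corolla_ar x).-1 < k.+1)%N by lia.
  rewrite (bigD1 (Ordinal ik)) //= big1 ?addr0 => [|i /eqP ii].
    by apply/esym; rewrite (_ : _ && _ = true) //; lia.
  case: eqP => // xi; case: ii; apply: val_inj => /=; lia.
rewrite big1 // => i _; have := ltn_ord i; case: eqP => // xi; case: eqP => // yi; lia.
Qed.

Definition corolla_coord q n : corolla_operad K gamma n -> K^o :=
  mlift (fun x : so_at C n => (corolla_le (val x) q)%:R : K^o).

Lemma corolla_coord_is_linear q n : linear (@corolla_coord q n).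
Proof. exact: mlift_is_linear. Qed.

Lemma corolla_coordU q n (x : so_at C n) :
  corolla_coord q (basis x) = (corolla_le (val x) q)%:R.
Proof. exact: mlift_basis. Qed.

Lemma corolla_coord_ar q n (u : corolla_operad K gamma n) :
  corolla_ar q <> n -> corolla_coord q u = 0.
Proof.
move=> qn; rewrite /corolla_coord mliftE big1 // => c _.
rewrite /corolla_le; case: eqP => [e|_]; last by rewrite scaler0.
by case: qn; rewrite -e; apply/eqP: (valP c).
Qed.

Definition coord q n (u : P n) : K^o := corolla_coord q (As_corolla u).

Lemma coord_is_linear q n : linear (@coord q n).
Proof. by move=> a u v; rewrite /coord As_corolla_is_linear corolla_coord_is_linear. Qed.

(** The transpose of [op_act]: the right-hand side is the sum by which [splits] opens a leaf, with
    the coefficient of e_g on f_c. This is the local form of the differential. *)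
Lemma coord_op_comp q n m (u : P n) (v : P m) g :
  coord q (op_comp P (erefl : (m + n).+1 = m.+1 + n)%N ord0
    (op_comp P (erefl : m.+2 = 2 + m)%N (lift ord0 ord0) (qproj R (generator K g)) v) u) =
  if q is CNode c k then label_mx g c * \sum_(i < k.+1)
    coord (corolla_of_ar c i) u * coord (corolla_of_ar c (k - i)) v else 0.
Proof.
rewrite /coord !As_corolla_comp As_corollaE (free_corollaU K (node_tree g)).
move: (As_corolla u) (As_corolla v) => {}u {}v.
pose lhs u v : K^o := corolla_coord q (op_comp (corolla_operad K gamma)
  (erefl : (m + n).+1 = m.+1 + n)%N ord0 (op_comp (corolla_operad K gamma)
   (erefl : m.+2 = 2 + m)%N (lift ord0 ord0) (basis (tree_corolla_at (node_tree g))) v) u).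
pose rhs u v : K^o := if q is CNode c k then label_mx g c * \sum_(i < k.+1)
    corolla_coord (n := n) (corolla_of_ar c i) u
      * corolla_coord (n := m) (corolla_of_ar c (k - i)) v else 0.
suff : lhs u v = rhs u v by [].
move: u; apply: linear_ext => [a u u'|a u u'|x].
- by rewrite /lhs op_compDr corolla_coord_is_linear.
- rewrite /rhs; case: (q) => [|c k]; first by rewrite scaler0 addr0.
  rewrite scalerAr scaler_sumr -mulrDr -big_split /=; congr (_ * _); apply: eq_bigr => i _.
  by rewrite corolla_coord_is_linear mulrDl scalerAl.
move: v; apply: linear_ext => [a u u'|a u u'|y].
- by rewrite /lhs op_compDr op_compDl corolla_coord_is_linear.
- rewrite /rhs; case: (q) => [|c k]; first by rewrite scaler0 addr0.
  rewrite scalerAr scaler_sumr -mulrDr -big_split /=; congr (_ * _); apply: eq_bigr => i _.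
  by rewrite corolla_coord_is_linear mulrDr scalerAr.
have -> : lhs (basis x) (basis y) =
    (corolla_le (corolla_star (corolla_star (CNode g 0) (val y)) (val x)) q)%:R.
  rewrite /lhs [X in op_comp _ _ _ X _]lin_compU [X in corolla_coord _ X]lin_compU.
  by rewrite corolla_coordU.
rewrite /rhs; case: (q) => [|c k].
  rewrite /corolla_le andbT; case: eqP => // e.
  have := @corolla_ar_star gamma (CNode g 0) 0 (val y) isT.
  have := @corolla_ar_star gamma (corolla_star (CNode g 0) (val y)) 0 (val x) (corolla_ar_gt0 _).
  by have := corolla_ar_gt0 (val x); have := corolla_ar_gt0 (val y); move: e => /=; lia.
by rewrite corolla_le_star; congr (_ * _); apply: eq_bigr => i _; rewrite !corolla_coordU.
Qed.

Lemma coord_quad (i : 'I_2) a b c :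
  coord (CNode c 1) (qproj R (quad K i a b)) = label_mx a c * label_mx b c.
Proof.
rewrite /coord As_corollaE; rewrite -> free_corolla_quad; rewrite corolla_coordU /=.
have -> : tree_corolla (if (i < 1)%N then Nd a (Nd b leaf leaf) leaf
    else Nd a leaf (Nd b leaf leaf))
   = CNode (lmax a b) 1 by case: ifP.
by rewrite /corolla_le /= leq_lmax !mxE -natrM mulnb.
Qed.

End Coordinates.

Lemma linear_fun_sum (K : fieldType) (V W : lmodType K) (f : V -> W) (I : Type)
    (r : seq I) (Q : pred I) (F : I -> V) : linear f ->
  f (\sum_(i <- r | Q i) F i) = \sum_(i <- r | Q i) f (F i).
Proof. by move=> fl; apply: (big_morph f (linear_funD fl) (linear_fun0 fl)). Qed.

Lemma span_sum (K : fieldType) (V : lmodType K) (X : V -> Prop) (I : Type)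
    (r : seq I) (Q : pred I) (F : I -> V) :
  (forall i, Q i -> span X (F i)) -> span X (\sum_(i <- r | Q i) F i).
Proof. by move=> FX; apply: big_ind => //; [apply: span0 | apply: spanD]. Qed.

(** Each monomial is reduced to the representative indexed by [h a b]; the second sum collects the
    coefficients of the representatives. *)
Lemma sum_reduction (K : fieldType) (V : lmodType K) (I : finType) (h : I -> I -> I)
    (k0 k1 : I -> I -> K) (q0 q1 : I -> I -> V) (Q : I -> V) :
  \sum_a \sum_b (k0 a b *: q0 a b + k1 a b *: q1 a b) =
  \sum_a \sum_b (k0 a b *: (q0 a b - Q (h a b)) + k1 a b *: (q1 a b - Q (h a b)))
  + \sum_c (\sum_a \sum_(b | h a b == c) (k0 a b + k1 a b)) *: Q c.
Proof.
have -> : \sum_c (\sum_a \sum_(b | h a b == c) (k0 a b + k1 a b)) *: Q c =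
    \sum_a \sum_b (k0 a b + k1 a b) *: Q (h a b).
  under eq_bigr => c _ do rewrite scaler_suml.
  rewrite exchange_big; apply: eq_bigr => a _ /=.
  under eq_bigr => c _ do rewrite scaler_suml.
  rewrite (exchange_big_dep predT) //=; apply: eq_bigr => b _.
  by rewrite (big_pred1 (h a b)) => [|e] //; rewrite eq_sym.
rewrite -big_split; apply: eq_bigr => a _; rewrite -big_split; apply: eq_bigr => b _ /=.
by rewrite !scalerBr scalerDl addrACA !subrK.
Qed.

(** * The Koszul dual cooperad in the new basis *)

Section KoszulDual.
Variables (K : fieldType) (gamma : nat).
Local Notation tree := (syntax_tree 'I_gamma).
Local Notation free := (free_operad 'I_gamma K).
Local Notation F := (free_set_operad 'I_gamma).
Local Notation R := (@As_rel K gamma).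
Local Notation M := (label_mx K gamma).
Implicit Types (a b c : 'I_gamma).

Lemma span_ideal3 (v : free 3%N) : span R v ->
  ideal (@in_arity3 K free R) v.
Proof.
elim=> [|a x y Rx _ IH]; first exact: ideal0.
by apply: idealP IH; apply: ideal_rel; apply: InArity3.
Qed.

(** From left to right, the coordinates on the corollas with three leaves vanish on the relations.
    Conversely, reduction to right combs leaves the coefficients [W], and the equations say that the
    row [W] is killed by the invertible matrix [label_mx]. *)
Lemma span_quad (k0 k1 : 'I_gamma -> 'I_gamma -> K) :
  span R (\sum_a \sum_b (k0 a b *: quad K ord0 a b + k1 a b *: quad K (lift ord0 ord0) a b)) <->
  forall c, \sum_a \sum_b M a c * M b c * (k0 a b + k1 a b) = 0.
Proof.
set v := \sum_a _; split=> [Rv c|sum0].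
  pose L (x : free 3%N) := coord (CNode c 1) (qproj R x).
  have Ll : linear L by move=> k x y; rewrite /L qproj_is_linear coord_is_linear.
  have L0 : L v = 0.
    rewrite /L; have -> : qproj R v = 0.
      by apply/(quot_piP _ v 0); rewrite subr0; apply/span_sub/span_ideal3.
    exact: linear_fun0 (@coord_is_linear _ _ _ _).
  rewrite -[RHS]L0 /v (linear_fun_sum _ _ _ Ll); apply: eq_bigr => a _.
  rewrite (linear_fun_sum _ _ _ Ll); apply: eq_bigr => b _.
  have LE k0' k1' : L (k0' *: quad K ord0 a b + k1' *: quad K (lift ord0 ord0) a b) =
      k0' * (M a c * M b c) + k1' * (M a c * M b c).
    have LD := linear_funD Ll; have LZ k := linear_funZ k Ll.
    rewrite /morphism_2 in LD; rewrite /morphism_1 in LZ.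
    rewrite -> LD; rewrite -> 2!LZ; rewrite /L.
    by rewrite -> 2!coord_quad.
  by rewrite -> LE; rewrite -mulrDl mulrC.
pose Q c := quad K (lift ord0 ord0) c c : free 3%N.
pose W c := \sum_a \sum_(b | lmax a b == c) (k0 a b + k1 a b).
have W0 c : W c = 0.
  have WM : (\row_c W c) *m M = 0.
    apply/rowP => d; rewrite !mxE -[RHS](sum0 d).
    under eq_bigr => e _ do rewrite mxE mulr_suml.
    rewrite exchange_big; apply: eq_bigr => a _ /=.
    under eq_bigr => e _ do rewrite mulr_suml.
    rewrite (exchange_big_dep predT) //=; apply: eq_bigr => b _.
    rewrite (big_pred1 (lmax a b)) => [|e]; last by rewrite eq_sym.
    by rewrite !mxE leq_lmax -natrM mulnb mulrC.
  have : (\row_c W c) = 0 by rewrite -[LHS](mulmxK (label_mx_unit K gamma)) WM mul0mx.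
  by move/rowP/(_ c); rewrite !mxE.
have Rq i a b : span R (quad K i a b - Q (lmax a b)).
  by apply: span_sub; exists a, b, i.
rewrite /v; rewrite -> (sum_reduction (@lmax gamma) k0 k1 _ _ Q).
have -> : \sum_c (\sum_a \sum_(b | lmax a b == c) (k0 a b + k1 a b)) *: Q c = 0.
  by apply: big1 => c _; rewrite -[X in X *: _]/(W c) W0 scale0r.
rewrite addr0.
apply: span_sum => a _; apply: span_sum => b _.
by apply: spanD; apply: spanZ.
Qed.

Lemma koszul_dualP n (x : free n) : koszul_dual R x <->
  forall (c : tree) i (s1 s2 s3 : tree) d, (i < leaves c)%N ->
    \sum_a \sum_b M a d * M b d * (tree_coef x (graft c i (Nd a (Nd b s1 s2) s3))
       + (-1) ^+ nodes s1 * tree_coef x (graft c i (Nd a s1 (Nd b s2 s3)))) = 0.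
Proof.
split=> [H c i s1 s2 s3 d ic|H c i s1 s2 s3 ic].
  by have /span_quad := H c i s1 s2 s3 ic; apply.
by apply/span_quad => d; apply: H.
Qed.

End KoszulDual.

Section KoszulDualRotation.
Variables (K : fieldType) (gamma : nat).
Local Notation tree := (syntax_tree 'I_gamma).
Local Notation free := (free_operad 'I_gamma K).
Local Notation R := (@As_rel K gamma).
Local Notation M := (label_mx K gamma).
Implicit Types (a b d e f : 'I_gamma) (c s t : tree) (A : 'M[K]_gamma).

Definition signed_rotation_invariant (X : tree -> K) : Prop :=
  forall c i d s1 s2 s3, (i < leaves c)%N ->
    X (graft c i (Nd d (Nd d s1 s2) s3))
    + (-1) ^+ nodes s1 * X (graft c i (Nd d s1 (Nd d s2 s3))) = 0.

Lemma relabel_at_ext A c s1 s2 s3 (X Y : tree -> tree -> tree -> tree -> K) :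
  (forall c' t1 t2 t3, nodes c' = nodes c -> nodes t1 = nodes s1 -> X c' t1 t2 t3 =
    Y c' t1 t2 t3) ->
  relabel_at A c s1 s2 s3 X = relabel_at A c s1 s2 s3 Y.
Proof.
by move=> XY; do 4![apply: relabel_ext => ? ? _]; apply: XY.
Qed.

Lemma relabel_atZD A c s1 s2 s3 k (X Y : tree -> tree -> tree -> tree -> K) :
  relabel_at A c s1 s2 s3 (fun c' t1 t2 t3 => X c' t1 t2 t3 + k * Y c' t1 t2 t3) =
  relabel_at A c s1 s2 s3 X + k * relabel_at A c s1 s2 s3 Y.
Proof.
rewrite /relabel_at -relabelZ -relabelD; apply: eq_relabel => c';
  rewrite -relabelZ -relabelD; apply: eq_relabel => t1.
by rewrite -relabelZ -relabelD; apply: eq_relabel => t2; rewrite -relabelZ -relabelD.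
Qed.

Lemma relabel_at0 A c s1 s2 s3 : relabel_at A c s1 s2 s3 (fun _ _ _ _ => 0) = 0.
Proof.
rewrite /relabel_at -[RHS](relabel0 A c); apply: eq_relabel => c';
  rewrite -[RHS](relabel0 A s1).
apply: eq_relabel => t1; rewrite -[RHS](relabel0 A s2); apply: eq_relabel => t2.
by rewrite -[RHS](relabel0 A s3).
Qed.

Lemma relabel_at_sum A c s1 s2 s3 (I : Type) (r : seq I) (k : I -> K)
    (X : I -> tree -> tree -> tree -> tree -> K) :
  \sum_(i <- r) k i * relabel_at A c s1 s2 s3 (X i) =
  relabel_at A c s1 s2 s3 (fun c' t1 t2 t3 => \sum_(i <- r) k i * X i c' t1 t2 t3).
Proof.
elim: r => [|i r IH].
  by rewrite big_nil -[LHS](relabel_at0 A c s1 s2 s3); apply: relabel_at_ext => *;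
    rewrite big_nil.
rewrite big_cons addrC IH -relabel_atZD; apply: relabel_at_ext => *.
by rewrite big_cons addrC.
Qed.

(** The transpose comes from the passage to coordinates: the coordinate on f_d is the sum over a of
    [M a d] times the coordinate on e_a. At an edge with both ends of label d, the quadratic
    condition then reads as a signed rotation. *)
Lemma koszul_dual_rotation n (x : free n) : koszul_dual R x ->
  signed_rotation_invariant (fun t => relabel M^T t (tree_coef x)).
Proof.
move/koszul_dualP => H c i d s1 s2 s3 ic.
rewrite relabel_graft_left // relabel_graft_right // mulr_sumr -big_split /=.
transitivity (\sum_a M a d * relabel_at M^T c s1 s2 s3 (fun c' t1 t2 t3 => \sum_b M b d *
   (tree_coef x (graft c' i (Nd a (Nd b t1 t2) t3))
    + (-1) ^+ nodes s1 * tree_coef x (graft c' i (Nd a t1 (Nd b t2 t3)))))).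
  apply: eq_bigr => a _; rewrite -relabel_at_sum !mulr_sumr -big_split;
    apply: eq_bigr => b _ /=.
  by rewrite relabel_atZD !mxE !mulrDr mulrA; congr (_ + _); ring.
rewrite relabel_at_sum -[RHS](relabel_at0 M^T c s1 s2 s3);
  apply: relabel_at_ext => c' t1 t2 t3 nc n1.
rewrite -[RHS](H c' i t1 t2 t3 d); last by rewrite nodes_leaves nc -nodes_leaves.
apply: eq_bigr => a _; rewrite mulr_sumr; apply: eq_bigr => b _.
by rewrite n1 mulrA.
Qed.

(** A bilinear form carried through a change of basis and back. Diagonal entries suffice: the
    monomial relations between distinct f_c and f_d put no constraint on the Koszul dual. *)
Lemma contract_labels (G : 'I_gamma -> 'I_gamma -> K) d :
  \sum_a \sum_b M a d * M b d * (\sum_e \sum_f (invmx M)^T a e * (invmx M)^T b f * G e f)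
  = G d d.
Proof.
pose g : 'M[K]_gamma := \matrix_(e, f) G e f.
have <- : (M^T *m ((invmx M)^T *m g *m invmx M) *m M) d d = G d d.
  rewrite !mulmxA -trmx_mul mulVmx ?label_mx_unit // trmx1 mul1mx.
  by rewrite -mulmxA mulVmx ?label_mx_unit // mulmx1 mxE.
rewrite [RHS]mxE [LHS]exchange_big; apply: eq_bigr => b _ /=.
rewrite [X in _ = X * _]mxE [RHS]mulr_suml; apply: eq_bigr => a _.
rewrite [X in _ = X * _ * _]mxE [RHS]mulrAC; congr (_ * _).
rewrite [RHS]mxE.
rewrite [LHS]exchange_big; apply: eq_bigr => f _ /=; rewrite [X in _ = X * _]mxE mulr_suml.
by apply: eq_bigr => e _; rewrite !mxE mulrAC.
Qed.

Lemma rotation_koszul_dual n (x : free n) (Y : tree -> K) :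
  signed_rotation_invariant Y -> (forall s, tree_coef x s = relabel (invmx M)^T s Y) ->
  koszul_dual R x.
Proof.
move=> YI xY; apply/koszul_dualP => c i s1 s2 s3 d ic.
pose T1 e f := relabel_at (invmx M)^T c s1 s2 s3 (fun c' t1 t2 t3 =>
  Y (graft c' i (Nd e (Nd f t1 t2) t3))).
pose T2 e f := relabel_at (invmx M)^T c s1 s2 s3 (fun c' t1 t2 t3 =>
  Y (graft c' i (Nd e t1 (Nd f t2 t3)))).
pose G e f := T1 e f + (-1) ^+ nodes s1 * T2 e f.
transitivity (G d d).
  rewrite -contract_labels; apply: eq_bigr => a _; apply: eq_bigr => b _; congr (_ * _).
  rewrite !xY relabel_graft_left // relabel_graft_right // mulr_sumr -big_split;
    apply: eq_bigr => e _ /=.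
  rewrite mulr_sumr -big_split; apply: eq_bigr => f _ /=.
  by rewrite /G mulrDr; congr (_ + _); rewrite mulrCA.
rewrite /G /T1 /T2 -relabel_atZD -[RHS](relabel_at0 (invmx M)^T c s1 s2 s3).
apply: relabel_at_ext => c' t1 t2 t3 nc n1; rewrite -n1; apply: YI.
by rewrite nodes_leaves nc -nodes_leaves.
Qed.

End KoszulDualRotation.

(** * Coordinates on the Koszul complex *)

Section TreeProduct.
Variables (K : fieldType) (G A : choiceType).
Implicit Types (x y : fmod K (btree G A)) (g : G).

Definition tree_prod g x y : fmod K (btree G A) :=
  mlift (fun l => mlift (fun r => (basis (Nd g l r) : fmod K (btree G A))) y) x.

Lemma tree_prodU g (l r : btree G A) :
  tree_prod g (basis l) (basis r) = basis (Nd g l r).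
Proof. by rewrite /tree_prod !mlift_basis. Qed.

Lemma tree_prod_linear_l g y : linear (fun x => tree_prod g x y).
Proof. exact: mlift_is_linear. Qed.

Lemma tree_prod_linear_r g x : linear (tree_prod g x).
Proof.
move=> a y y'; apply: etrans _ (mlift_combE _ _ _ _).
by apply: eq_mlift => l; apply: mlift_is_linear.
Qed.

Lemma tree_prod_nd_l g x y : tree_prod g x y = mlift (fun r => mlift (fun l =>
  (basis (Nd g l r) : fmod K (btree G A))) x) y.
Proof.
move: x; apply: linear_ext => [a u v|a u v|l]; first exact: tree_prod_linear_l.
  by apply: etrans _ (mlift_combE _ _ _ _); apply: eq_mlift => r; apply: mlift_is_linear.
rewrite /tree_prod mlift_basis; apply: eq_mlift => r.
by rewrite mlift_basis.
Qed.

Lemma coef_tree_prod g g' l r x y :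
  coef (Nd g' l r) (tree_prod g x y) = (g == g')%:R * (coef l x * coef r y).
Proof.
move: x; pose W := (K^o : lmodType K).
apply: (@linear_ext _ _ W (fun x => coef (Nd g' l r) (tree_prod g x y))
  (fun x => (g == g')%:R * (coef l x * coef r y))) => [a u v|a u v|l'].
- by rewrite tree_prod_linear_l coefD coefZ.
- by rewrite coefD coefZ mulrDl mulrDr -mulrA scalerAr.
move: y; apply: (@linear_ext _ _ W (fun y => coef (Nd g' l r) (tree_prod g (basis l') y))
  (fun y => (g == g')%:R * (coef l (basis l') * coef r y))) => [a u v|a u v|r'].
- by rewrite tree_prod_linear_r coefD coefZ.
- rewrite coefD coefZ !mulrDr; congr (_ + _).
  by rewrite -[RHS]/(a * _); ring.
rewrite tree_prodU !coef_basis -!natrM !mulnb; congr (nat_of_bool _)%:R.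
by apply/eqP/and3P => [[-> -> ->] | [/eqP-> /eqP-> /eqP->]].
Qed.

Lemma coef_tree_prod_leaf g q x y : coef (Lf q) (tree_prod g x y) = 0.
Proof.
rewrite /tree_prod mliftE coef_sum big1 // => l _;
  rewrite coefZ mliftE coef_sum big1 ?mulr0 // => r _.
rewrite coefZ coef_basis; case: eqP => //; by rewrite mulr0.
Qed.

End TreeProduct.

HB.lock Definition comp_prod (K : fieldType) (G : choiceType) (P : operad K) (g : G)
    (z w : composite G P) : composite G P :=
  quot_pi _ (tree_prod g (quot_repr z) (quot_repr w)).

Section CompositeProduct.
Variables (K : fieldType) (G : choiceType) (P : operad K).
Local Notation tree := (ttree G P).
Local Notation rel := (@multilinear_rel K G P).
Local Notation comp := (composite G P).
Implicit Types (x y : fmod K tree) (g : G).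

Lemma span_tree_prod_l g x y : span rel x -> span rel (tree_prod g x y).
Proof. by move=> Rx; rewrite tree_prod_nd_l; apply: span_mlift => r; apply: span_nd_l. Qed.

Lemma span_tree_prod_r g x y : span rel y -> span rel (tree_prod g x y).
Proof. by move=> Ry; apply: span_mlift => l; apply: span_nd_r. Qed.

Definition comp_pi (x : fmod K tree) : comp := quot_pi rel x.

Lemma comp_pi_is_linear : linear comp_pi.
Proof. exact: quot_pi_is_linear. Qed.

Lemma comp_pi_ind (Q : comp -> Prop) : (forall x, Q (comp_pi x)) -> forall z, Q z.
Proof. exact: quot_ind. Qed.

Lemma comp_prodE g x y : comp_prod g (comp_pi x) (comp_pi y) = comp_pi (tree_prod g x y).
Proof.
rewrite comp_prod.unlock; apply/quot_piP; set x' := quot_repr _; set y' := quot_repr _.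
have -> : tree_prod g x' y' - tree_prod g x y =
    tree_prod g (x' - x) y' + tree_prod g x (y' - y).
  by rewrite (linear_funB (tree_prod_linear_l g y')) (linear_funB (tree_prod_linear_r g x)) subrKA.
apply: spanD; first by apply: span_tree_prod_l; apply: quot_pi_repr.
by apply: span_tree_prod_r; apply: quot_pi_repr.
Qed.

Lemma comp_prod_linear_l g (w : comp) : linear (fun z : comp => comp_prod g z w).
Proof.
move=> a; elim/comp_pi_ind=> x; elim/comp_pi_ind=> y; elim/comp_pi_ind: w => w.
transitivity (comp_prod g (comp_pi (a *: x + y)) (comp_pi w)).
  by rewrite comp_pi_is_linear.
rewrite 3!comp_prodE tree_prod_linear_l.
exact: comp_pi_is_linear.
Qed.

Lemma comp_prod_linear_r g (z : comp) : linear (comp_prod g z : comp -> comp).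
Proof.
move=> a; elim/comp_pi_ind=> x; elim/comp_pi_ind=> y; elim/comp_pi_ind: z => z.
transitivity (comp_prod g (comp_pi z) (comp_pi (a *: x + y))).
  by rewrite comp_pi_is_linear.
rewrite 3!comp_prodE tree_prod_linear_r.
exact: comp_pi_is_linear.
Qed.

Definition comp_leaf n (u : P n) : comp := comp_pi (basis (Lf (mk_homog u))).

Lemma comp_leaf_is_linear n : linear (@comp_leaf n).
Proof.
move=> a u v; rewrite -[RHS]/(a *: comp_pi _ + comp_pi _).
transitivity (comp_pi (a *: basis (Lf (mk_homog u)) + basis (Lf (mk_homog v))));
  last exact: comp_pi_is_linear.
apply/quot_piP.
by apply: leaf_linear_span; apply: leaf_linear_Lf.
Qed.

End CompositeProduct.

Section Evaluation.
Variables (K : fieldType) (gamma : nat).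
Local Notation free := (free_operad 'I_gamma K).
Local Notation F := (free_set_operad 'I_gamma).
Local Notation C := (corolla_set_operad gamma).
Local Notation R := (@As_rel K gamma).
Local Notation P := (As K gamma).
Local Notation M := (label_mx K gamma).
Local Notation V := (invmx (label_mx K gamma)).
Local Notation dtree := (btree 'I_gamma (corolla gamma)).
Local Notation ttree := (ttree 'I_gamma P).
Local Notation comp := (composite 'I_gamma P).
Local Notation rel := (@multilinear_rel K 'I_gamma P).
Implicit Types (a b c g : 'I_gamma) (q : corolla gamma) (t : dtree) (s : ttree).

Definition homog_coord q (x : homog P) : K :=
  let: existT n u := x in coord q (u : P n).

Fixpoint eval_tree t s : K :=
  match t, s with
  | Lf q, Lf x => homog_coord q x
  | Nd c l r, Nd g l' r' => M g c * (eval_tree l l' * eval_tree r r')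
  | _, _ => 0
  end.

Lemma eval_leaf_linear k s1 s2 s3 t : leaf_linear k s1 s2 s3 ->
  eval_tree t s3 = k * eval_tree t s1 + eval_tree t s2.
Proof.
move=> h; elim: h t => {s1 s2 s3} [n u v|g l1 l2 l3 r _ IH|g l r1 r2 r3 _ IH] [q|c tl tr] /=.
- exact: coord_is_linear.
- by rewrite mulr0 addr0.
- by rewrite mulr0 addr0.
- by rewrite IH; ring.
- by rewrite mulr0 addr0.
- by rewrite IH; ring.
Qed.

Definition eval_lin t : fmod K ttree -> K^o := mlift (fun s => (eval_tree t s : K^o)).

Lemma eval_lin_is_linear t : linear (eval_lin t).
Proof. exact: mlift_is_linear. Qed.

HB.instance Definition _ t := GRing.isLinear.Build K (fmod K ttree) K^o *:%R
  (eval_lin t) (eval_lin_is_linear t).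

Lemma eval_linU t s : eval_lin t (basis s) = eval_tree t s.
Proof. exact: mlift_basis. Qed.

Lemma eval_lin_rel t x : rel x -> eval_lin t x = 0.
Proof.
case=> k [s1 [s2 [s3 [h ->]]]].
transitivity (eval_lin t (basis s3) - eval_lin t (k *: basis s1 + basis s2)).
  exact: linear_funB (eval_lin_is_linear t) _ _.
rewrite -> eval_lin_is_linear, 3!eval_linU.
by rewrite (eval_leaf_linear t h) subrr.
Qed.

(* The coordinate of index t in the basis of the composite obtained from the bases f
   of the generators and of the corollas. *)
Definition kappa t : comp -> K^o := quot_lift (eval_lin t).

Lemma kappa_is_linear t : linear (kappa t).
Proof. exact: quot_lift_is_linear (@eval_lin_rel t). Qed.

Lemma kappaE t x : kappa t (comp_pi x) = eval_lin t x.
Proof. exact: quot_liftE (@eval_lin_rel t) x. Qed.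

Definition corolla_at c k : so_at C k.+2 :=
  exist (fun z : C => so_ar z == k.+2) (CNode c k) (eqxx _).

Definition corolla_elt c k : P k.+2 := corolla_As (basis (corolla_at c k)).

(** The corolla of f_c with k + 2 leaves: [V] inverts the expansion of the e_a on the f_c. *)
Definition dual_elt c k : P k.+2 := \sum_a V c a *: corolla_elt a k.

Definition dual_leaf q : homog P :=
  if q is CNode c k then mk_homog (dual_elt c k) else mk_homog (op_one P).

Lemma coord_corolla_elt q a k : coord q (corolla_elt a k) = (corolla_le (CNode a k) q)%:R.
Proof. by rewrite /coord corolla_AsK corolla_coordU. Qed.

Lemma coord_one q : coord q (op_one P) = (q == CLeaf gamma)%:R.
Proof.
rewrite /coord As_corolla_one [LHS]corolla_coordU /corolla_le /=.
by case: q => [|a k].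
Qed.

Lemma coord_dual_elt q c k : coord q (dual_elt c k) = (q == CNode c k)%:R.
Proof.
rewrite (linear_fun_sum _ _ _ (@coord_is_linear K gamma q k.+2)).
under eq_bigr => a _ do rewrite (linear_funZ _ (@coord_is_linear K gamma q k.+2)) coord_corolla_elt.
case: q => [|d m].
  by rewrite big1 // => a _; rewrite /corolla_le /= scaler0.
have [->|km] := eqVneq m k; last first.
  rewrite big1 => [|a _]; first by case: eqP => // -[_ e]; rewrite e eqxx in km.
  by rewrite /corolla_le /= !eqSS eq_sym (negbTE km) scaler0.
have := congr1 (fun A : 'M[K]_gamma => A c d) (mulVmx (label_mx_unit K gamma)).
rewrite /invmx -/(invmx _) !mxE => E.
have -> : (CNode d k == CNode c k) = (c == d) by apply/eqP/eqP => [[->]|->].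
rewrite -E; apply: eq_bigr => a _; rewrite mxE.
by rewrite /corolla_le /= eqxx.
Qed.

Lemma homog_coord_dual q q' : homog_coord q (dual_leaf q') = (q == q')%:R.
Proof. by case: q' => [|c k]; [apply: coord_one | apply: coord_dual_elt]. Qed.

Definition comp_node c (z w : comp) : comp := \sum_a V c a *: comp_prod a z w.

Lemma comp_prod_node g z w : comp_prod g z w = \sum_c M g c *: comp_node c z w.
Proof.
under eq_bigr => c _ do rewrite /comp_node scaler_sumr.
rewrite exchange_big (bigD1 g) //= [X in _ + X]big1 ?addr0 => [|a ag].
  under eq_bigr => c _ do rewrite scalerA.
  have := congr1 (fun A : 'M[K]_gamma => A g g) (mulmxV (label_mx_unit K gamma)).
  by rewrite /= [in RHS]mxE eqxx mxE -scaler_suml => ->; rewrite scale1r.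
under eq_bigr => c _ do rewrite scalerA.
have := congr1 (fun A : 'M[K]_gamma => A g a) (mulmxV (label_mx_unit K gamma)).
by rewrite /= [in RHS]mxE eq_sym (negbTE ag) mxE -scaler_suml => ->; rewrite scale0r.
Qed.

Fixpoint dual_tree t : comp :=
  match t with
  | Lf q => comp_pi (basis (Lf (dual_leaf q)))
  | Nd c l r => comp_node c (dual_tree l) (dual_tree r)
  end.

Definition dual_sum (x : fmod K dtree) : comp := mlift dual_tree x.

End Evaluation.

Section KappaInjective.
Variables (K : fieldType) (gamma : nat).
Local Notation C := (corolla_set_operad gamma).
Local Notation P := (As K gamma).
Local Notation M := (label_mx K gamma).
Local Notation dtree := (btree 'I_gamma (corolla gamma)).
Local Notation ttree := (ttree 'I_gamma P).
Local Notation comp := (composite 'I_gamma P).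
Implicit Types (a b c g : 'I_gamma) (q : corolla gamma) (t : dtree) (s : ttree).

Lemma dual_sum_is_linear : linear (@dual_sum K gamma).
Proof. exact: mlift_is_linear. Qed.

Lemma dual_sumU t : @dual_sum K gamma (basis t) = dual_tree K t.
Proof. exact: mlift_basis. Qed.

Lemma comp_node_linear_l c (w : comp) : linear (fun z : comp => comp_node c z w).
Proof.
move=> k z z'; rewrite /comp_node scaler_sumr -big_split; apply: eq_bigr => a _ /=.
by rewrite comp_prod_linear_l scalerDr !scalerA mulrC.
Qed.

Lemma comp_node_linear_r c (z : comp) : linear (comp_node c z).
Proof.
move=> k w w'; rewrite /comp_node scaler_sumr -big_split; apply: eq_bigr => a _ /=.
by rewrite comp_prod_linear_r scalerDr !scalerA mulrC.
Qed.

Lemma dual_sum_prod c (x y : fmod K dtree) :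
  dual_sum (tree_prod c x y) = comp_node c (dual_sum x) (dual_sum y).
Proof.
move: x; apply: linear_ext => [k u v|k u v|l].
- by rewrite tree_prod_linear_l dual_sum_is_linear.
- by rewrite dual_sum_is_linear comp_node_linear_l.
move: y; apply: linear_ext => [k u v|k u v|r].
- by rewrite tree_prod_linear_r dual_sum_is_linear.
- by rewrite dual_sum_is_linear comp_node_linear_r.
by rewrite tree_prodU; rewrite -> 3!dual_sumU.
Qed.

Definition corollas (n : nat) : seq (corolla gamma) :=
  match n with
  | 0 => [::]
  | 1 => [:: CLeaf gamma]
  | k.+2 => [seq CNode c k | c <- enum 'I_gamma]
  end.

Lemma mem_corollas n q : (q \in corollas n) = (corolla_ar q == n).
Proof.
case: n q => [|[|k]] [|c m] //=; rewrite ?inE //.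
  by apply/mapP => -[].
apply/mapP/eqP => [[d _ [_ ->]] //|[->]].
by exists c; rewrite ?mem_enum.
Qed.

Lemma uniq_corollas n : uniq (corollas n).
Proof. by case: n => [|[|k]] //=; rewrite map_inj_uniq ?enum_uniq // => c d []. Qed.

Lemma comp_leaf_expansion n (u : P n) :
  comp_leaf 'I_gamma u = \sum_(q <- corollas n) coord q u *: dual_tree K (Lf q).
Proof.
rewrite -[u](@As_corollaK K gamma n); move: (As_corolla u) => {u}.
apply: linear_ext => [k u v|k u v|x].
- by rewrite corolla_As_is_linear comp_leaf_is_linear.
- rewrite scaler_sumr -big_split; apply: eq_bigr => q _ /=.
  by rewrite corolla_As_is_linear coord_is_linear scalerDl scalerA.
case: n x => [|[|k]] x.
- by case: x => -[].
- rewrite big_seq1.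
  have -> : corolla_As (basis x) = op_one P.
    have -> : x = so_one_at C by apply: val_inj; case: x => -[].
    transitivity (corolla_As (As_corolla (op_one P))); last exact: As_corollaK.
    exact: congr1 (esym (@As_corolla_one K gamma)).
  by rewrite coord_one eqxx scale1r.
have [a ->] : exists a, x = corolla_at a k.
  case: x => -[//|a m] /= e; exists a; apply: val_inj => /=.
  by case/eqP: (e) => ->.
rewrite -/(corolla_elt K a k) /= big_map big_enum /=.
under eq_bigr => c _ do rewrite coord_corolla_elt -[X in _ *: X]/(comp_leaf 'I_gamma (dual_elt K c k)).
transitivity (comp_leaf 'I_gamma (\sum_c M a c *: dual_elt K c k)); last first.
  have L := @comp_leaf_is_linear K 'I_gamma P k.+2.
  transitivity (\sum_c comp_leaf 'I_gamma (M a c *: dual_elt K c k)).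
    exact: linear_fun_sum L.
  apply: eq_bigr => c _; transitivity (M a c *: comp_leaf 'I_gamma (dual_elt K c k)).
    exact: linear_funZ L _.
  by rewrite [M a c]mxE /corolla_le eqxx.
congr (comp_leaf _ _); rewrite /dual_elt.
under [RHS]eq_bigr => c _ do rewrite scaler_sumr.
rewrite exchange_big (bigD1 a) //= [X in _ + X]big1 ?addr0 => [|b ba].
  under eq_bigr => c _ do rewrite scalerA.
  have := congr1 (fun A : 'M[K]_gamma => A a a) (mulmxV (label_mx_unit K gamma)).
  by rewrite /= [in RHS]mxE eqxx mxE -scaler_suml => ->; rewrite scale1r.
under eq_bigr => c _ do rewrite scalerA.
have := congr1 (fun A : 'M[K]_gamma => A a b) (mulmxV (label_mx_unit K gamma)).
by rewrite /= [in RHS]mxE eq_sym (negbTE ba) mxE -scaler_suml => ->; rewrite scale0r.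
Qed.

Lemma coef_basis_leaf q t :
  coef t (basis (Lf q : dtree) : fmod K dtree) = (if t is Lf q' then (q == q')%:R else 0).
Proof.
rewrite coef_basis; case: t => [q'|c l r]; last by case: eqP.
by congr (nat_of_bool _)%:R; apply/eqP/eqP => [[->]|->].
Qed.

(** The coordinates of a given [s] have finite support, as the labels are finite in number and each
    leaf of [s] has a fixed arity. The witness follows the structure of [s], with [corollas] at the
    leaves and [label_mx] at the nodes. *)
Lemma tree_expansion s : exists2 y : fmod K dtree,
  forall t, coef t y = eval_tree t s & dual_sum y = comp_pi (basis s).
Proof.
elim: s => [[n u]|g l [y yl El] r [z zr Er]].
  exists (\sum_(q <- corollas n) coord q u *: basis (Lf q : dtree)) => [t|].
    rewrite coef_sum; under eq_bigr => q _ do rewrite coefZ coef_basis_leaf.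
    case: t => [q|c tl tr] /=; last first.
      by rewrite big1_seq // => q _; rewrite mulr0.
    have [qn|qn] := boolP (q \in corollas n).
      rewrite (bigD1_seq q) ?uniq_corollas //= eqxx mulr1 big1 ?addr0 // => q' ne.
      by rewrite (negbTE ne) mulr0.
    rewrite big1_seq => [|q' /andP[_ q'n]].
      by rewrite /coord corolla_coord_ar //; apply/eqP; rewrite -mem_corollas.
    by case: eqP q'n qn => [-> ->|]; rewrite ?mulr0.
  rewrite (linear_fun_sum _ _ _ dual_sum_is_linear) -[RHS]/(comp_leaf 'I_gamma u) comp_leaf_expansion.
  by apply: eq_bigr => q _; rewrite (linear_funZ _ dual_sum_is_linear) dual_sumU.
exists (\sum_c M g c *: tree_prod c y z) => [t|].
  rewrite coef_sum; under eq_bigr => c _ do rewrite coefZ.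
  case: t => [q|c tl tr] /=.
    by rewrite big1 // => c _; rewrite coef_tree_prod_leaf mulr0.
  under eq_bigr => d _ do rewrite coef_tree_prod.
  rewrite (bigD1 c) //= big1 ?addr0 => [|d dc]; first by rewrite eqxx mul1r yl zr.
  by rewrite (negbTE dc) mul0r mulr0.
rewrite (linear_fun_sum _ _ _ dual_sum_is_linear) -tree_prodU -comp_prodE comp_prod_node.
by apply: eq_bigr => c _; rewrite (linear_funZ _ dual_sum_is_linear) dual_sum_prod El Er.
Qed.

Lemma kappa_inj (z : comp) : (forall t, kappa t z = 0) -> z = 0.
Proof.
elim/comp_pi_ind: z => x x0.
(* It suffices to rebuild the class of [x] from its own coordinates, which are all zero. *)
suff [y yx <-] : exists2 y : fmod K dtree, forall t, coef t y = eval_lin t x & dual_sum y =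
  comp_pi x.
  have -> : y = 0 by apply/coefP => t; rewrite yx -kappaE x0 coef0.
  exact: linear_fun0 dual_sum_is_linear.
have lin0 := linear_fun0 (@eval_lin_is_linear K gamma _).
rewrite [x]fmodE {x0}; elim: (enum_fset (supp x)) => [|s r [y yr Er]].
  exists 0 => [t|]; first by rewrite big_nil coef0 lin0.
  by rewrite big_nil (linear_fun0 dual_sum_is_linear) (linear_fun0 (@comp_pi_is_linear _ _ _)).
have [y' ys Es] := tree_expansion s.
exists (coef s x *: y' + y) => [t|].
  by rewrite big_cons eval_lin_is_linear eval_linU coefD coefZ ys yr.
by rewrite big_cons dual_sum_is_linear comp_pi_is_linear Es Er.
Qed.

End KappaInjective.

(** * The differential in coordinates *)

Section KappaDifferential.
Variables (K : fieldType) (gamma : nat).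
Local Notation P := (As K gamma).
Local Notation R := (@As_rel K gamma).
Local Notation M := (label_mx K gamma).
Local Notation dtree := (btree 'I_gamma (corolla gamma)).
Local Notation ttree := (ttree 'I_gamma P).
Local Notation comp := (composite 'I_gamma P).
Local Notation h := (fun g : 'I_gamma => qproj R (generator K g)).
Implicit Types (a b c g : 'I_gamma) (q : corolla gamma) (t : dtree) (s : ttree).

Lemma eval_nodes t s : nodes t <> nodes s -> eval_tree t s = 0.
Proof.
elim: t s => [q|c l IHl r IHr] [x|g l' r'] //= ne.
have [e|ne1] := eqVneq (nodes l) (nodes l'); last by rewrite IHl ?mul0r ?mulr0 //; apply/eqP.
by rewrite (IHr r') ?mulr0 // => e'; apply: ne; rewrite e e'.
Qed.

Lemma eval_linP t k (x y : fmod K ttree) :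
  eval_lin t (k *: x + y) = (k * eval_lin t x + eval_lin t y : K).
Proof. exact: eval_lin_is_linear. Qed.

Lemma regular_scaleE (k x y : K) : k *: (x : K^o) + (y : K^o) = (k * x + y : K).
Proof. by []. Qed.

Lemma nd_l_is_linear g (r : ttree) : linear (nd_l g r).
Proof. exact: mlift_is_linear. Qed.

Lemma nd_r_is_linear g (l : ttree) : linear (nd_r g l).
Proof. exact: mlift_is_linear. Qed.

Lemma eval_lin_nd_l c tl tr g (r : ttree) (x : fmod K ttree) :
  eval_lin (Nd c tl tr) (nd_l g r x) = M g c * ((eval_lin tl x : K) * eval_tree tr r).
Proof.
move: x; apply: linear_ext => [k u v|k u v|l].
- by rewrite nd_l_is_linear eval_lin_is_linear.
- by rewrite eval_linP regular_scaleE mulrDl mulrDr -mulrA mulrCA.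
by rewrite /nd_l mlift_basis !eval_linU.
Qed.

Lemma eval_lin_nd_r c tl tr g (l : ttree) (x : fmod K ttree) :
  eval_lin (Nd c tl tr) (nd_r g l x) = M g c * (eval_tree tl l * (eval_lin tr x : K)).
Proof.
move: x; apply: linear_ext => [k u v|k u v|r].
- by rewrite nd_r_is_linear eval_lin_is_linear.
- by rewrite eval_linP regular_scaleE !mulrDr (mulrCA (eval_tree tl l)) (mulrCA (M g c)).
by rewrite /nd_r mlift_basis !eval_linU.
Qed.

Lemma eval_lin_leaf_nd_l q g (r : ttree) (x : fmod K ttree) : eval_lin (Lf q) (nd_l g r x) = 0.
Proof.
move: x; apply: linear_ext => [k u v|k u v|l]; last by rewrite /nd_l mlift_basis eval_linU.
  by rewrite nd_l_is_linear eval_lin_is_linear.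
by rewrite scaler0 addr0.
Qed.

Lemma eval_lin_leaf_nd_r q g (l : ttree) (x : fmod K ttree) : eval_lin (Lf q) (nd_r g l x) = 0.
Proof.
move: x; apply: linear_ext => [k u v|k u v|r]; last by rewrite /nd_r mlift_basis eval_linU.
  by rewrite nd_r_is_linear eval_lin_is_linear.
by rewrite scaler0 addr0.
Qed.

Definition tree_sign t : K := (-1) ^+ left_nodes t.

Lemma tree_signK t : tree_sign t * tree_sign t = 1.
Proof. by rewrite /tree_sign -exprD addnn -signr_odd odd_double. Qed.

(** Conjugation by [tree_sign] turns the sign of [ttree_diff], which counts the preceding nodes,
    into that of [splits], which counts the preceding leaves. *)
Lemma eval_diff t s :
  eval_lin t (ttree_diff h s) = tree_sign t * splits t (fun t' =>
    tree_sign t' * eval_tree t' s).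
Proof.
elim: s t => [x|g l IHl r IHr] t /=.
  rewrite (linear_fun0 (@eval_lin_is_linear K gamma t)).
  have -> : splits t (fun t' => tree_sign t' * eval_tree t' (Lf x)) = splits t (fun=> 0 * 0);
    last by rewrite splitsZ !(mul0r, mulr0).
  apply: splits_ext => t' lt' _ _ _; rewrite mul0r; case: t' lt' => [q|? ? ?] //=;
    last by rewrite mulr0.
  by rewrite nodes_leaves.
have L := @eval_lin_is_linear K gamma t.
rewrite !(linear_funB L) (linear_funZ _ L).
case: t L => [q|c tl tr] L.
  rewrite eval_lin_leaf_nd_l eval_lin_leaf_nd_r scaler0 !subr0 /tree_sign /= mul1r.
  case: l {IHl} => [[n u]|g1 l1 l2]; last first.
    rewrite (linear_fun0 L); case: q {L} => [|c k] //=.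
    by rewrite big1 // => i _; rewrite mul0r !mulr0.
  case: r {IHr} => [[m v]|g1 r1 r2]; last first.
    rewrite (linear_fun0 L); case: q {L} => [|c k] //=.
    by rewrite big1 // => i _; rewrite !mulr0.
  rewrite eval_linU [LHS]coord_op_comp; case: q {L} => [|c k] //=.
  by rewrite mulr_sumr; apply: eq_bigr => i _; rewrite mul1r.
rewrite eval_lin_nd_l eval_lin_nd_r IHl IHr.
have -> : eval_lin (Nd c tl tr) (match l, r with
   | Lf x, Lf y => basis (Lf (op_act h g x y)) | _, _ => 0 end) = 0.
  case: (l) => [x|? ? ?]; last exact: linear_fun0.
  by case: (r) => [y|? ? ?]; [rewrite eval_linU | exact: linear_fun0].
rewrite sub0r splits_Nd.
have -> : splits tl (fun l' => tree_sign (Nd c l' tr) * eval_tree (Nd c l' tr) (Nd g l r)) =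
    - (tree_sign tr * (-1) ^+ nodes tl * (M g c * eval_tree tr r)) * splits tl (fun l' =>
      tree_sign l' * eval_tree l' l).
  rewrite -splitsZ; apply: splits_ext => l' nl' _ _ _ /=; rewrite /tree_sign /= !exprD.
  have -> : nodes l' = (nodes tl).+1 by apply: succn_inj; rewrite -!nodes_leaves.
  by rewrite exprS; ring.
have -> : splits tr (fun r' => tree_sign (Nd c tl r') * eval_tree (Nd c tl r') (Nd g l r)) =
    (tree_sign tl * (-1) ^+ nodes tl * (M g c * eval_tree tl l)) * splits tr (fun r' =>
      tree_sign r' * eval_tree r' r).
  by rewrite -splitsZ; apply: splits_eq => r' /=; rewrite /tree_sign /= !exprD; ring.
(* When [tl] and [l] have different numbers of nodes, the evaluation of [l] on [tl] is zero. *)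
have -> : (-1) ^+ nodes l *: (M g c * (eval_tree tl l * (tree_sign tr * splits tr (fun t' =>
  tree_sign t' * eval_tree t' r))) : K^o) =
   (-1) ^+ nodes tl * (M g c * (eval_tree tl l * (tree_sign tr * splits tr (fun t' =>
     tree_sign t' * eval_tree t' r)))).
  have [->|ne] := eqVneq (nodes tl) (nodes l); first by [].
  by rewrite eval_nodes ?mul0r ?mulr0 ?scaler0 //; apply/eqP.
rewrite nodes_leaves /tree_sign /= !exprD exprS.
have s1 n : (-1) ^+ n * (-1) ^+ n = 1 :> K by rewrite -exprD addnn -signr_odd odd_double.
move: (s1 (left_nodes tl)) (s1 (left_nodes tr)) (s1 (nodes tl)).
move: ((-1) ^+ left_nodes tl) ((-1) ^+ left_nodes tr) ((-1) ^+ nodes tl) => x y z xx yy zz.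
move: (splits tl _) (splits tr _) => sl sr.
(* The signs [x], [y] and [z] square to one; their squares are inserted to make both sides equal as
   polynomials. *)
transitivity (- (M g c * (x * sl * eval_tree tr r)) * (y * y) * (z * z)
   - z * (M g c * (eval_tree tl l * (y * sr))) * (x * x) * (z * z)).
  by rewrite xx yy zz; ring.
ring.
Qed.

Lemma splitsD t (u v : dtree -> K) : splits t (fun t' => u t' + v t') = splits t u + splits t v.
Proof.
elim: t u v => [[|c k]|c l IHl r IHr] u v /=; first by rewrite addr0.
  by rewrite -big_split.
by rewrite IHl IHr mulrDr addrACA.
Qed.

Lemma eval_lin_diff t (x : fmod K ttree) :
  eval_lin t (mlift (ttree_diff h) x) = tree_sign t * splits t (fun t' =>
    tree_sign t' * (eval_lin t' x : K)).
Proof.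
move: x; apply: linear_ext => [k u v|k u v|s].
- by rewrite (mlift_is_linear (ttree_diff h) k u v) eval_lin_is_linear.
- rewrite regular_scaleE mulrCA -mulrDr; congr (_ * _); rewrite -splitsZ -splitsD.
  by apply: splits_eq => t'; rewrite eval_linP mulrDr mulrCA.
rewrite mlift_basis eval_diff; congr (_ * _); apply: splits_eq => t'.
by rewrite eval_linU.
Qed.

Lemma kappa_diff t (z : comp) :
  kappa t (koszul_diff z) = tree_sign t * splits t (fun t' => tree_sign t' * (kappa t' z : K)).
Proof.
elim/comp_pi_ind: z => x; rewrite /koszul_diff.
have -> : composite_diff h (comp_pi x) =
  comp_pi (mlift (ttree_diff h) x) by exact: composite_diffE.
rewrite kappaE eval_lin_diff; congr (_ * _); apply: splits_eq => t'.
by rewrite kappaE.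
Qed.

End KappaDifferential.

(** * Coordinates of the chains *)

Section Tensors.
Variables (K : fieldType) (gamma : nat).
Local Notation P := (As K gamma).
Local Notation R := (@As_rel K gamma).
Local Notation M := (label_mx K gamma).
Local Notation V := (invmx (label_mx K gamma)).
Local Notation free := (free_operad 'I_gamma K).
Local Notation F := (free_set_operad 'I_gamma).
Local Notation tree := (syntax_tree 'I_gamma).
Local Notation dtree := (btree 'I_gamma (corolla gamma)).
Local Notation comp := (composite 'I_gamma P).
Implicit Types (a b c g : 'I_gamma) (q : corolla gamma) (t : dtree) (s : tree).

Fixpoint shape t : tree := if t is Nd c l r then Nd c (shape l) (shape r) else leaf.

Fixpoint leaf_seq t : seq (corolla gamma) :=
  match t with Lf q => [:: q] | Nd _ l r => leaf_seq l ++ leaf_seq r end.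

Fixpoint decorated s (p : nat -> corolla gamma) : dtree :=
  match s with
  | Lf _ => Lf (p 0%N)
  | Nd g l r => Nd g (decorated l p) (decorated r (fun j => p (leaves l + j)%N))
  end.

Fixpoint leaf_pairing (l : seq (corolla gamma)) (p : nat -> homog P) : K :=
  if l is q :: l' then homog_coord q (p 0%N) * leaf_pairing l' (fun j => p j.+1) else 1.

Lemma shape_nodes t : nodes (shape t) = nodes t.
Proof. by elim: t => //= c l -> r ->. Qed.

Lemma shape_left_nodes t : left_nodes (shape t) = left_nodes t.
Proof. by elim: t => //= c l -> r ->; rewrite shape_nodes. Qed.

Lemma size_leaf_seq t : size (leaf_seq t) = leaves t.
Proof. by elim: t => //= c l IHl r IHr; rewrite size_cat IHl IHr. Qed.

Lemma total_ar_leaf_seq t : total_ar t = sumn (map (@corolla_ar gamma) (leaf_seq t)).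
Proof. by elim: t => [q|c l IHl r IHr] /=; rewrite ?addn0 // map_cat sumn_cat IHl IHr. Qed.

Lemma decorated_leaves s p : leaves (decorated s p) = leaves s.
Proof. by elim: s p => //= c l IHl r IHr p; rewrite IHl IHr. Qed.

Lemma leaf_pairing_cat l l' p :
  leaf_pairing (l ++ l') p = leaf_pairing l p * leaf_pairing l' (fun j => p (size l + j)%N).
Proof. by elim: l p => [|q l IH] p /=; rewrite ?mul1r // IH mulrA. Qed.

Lemma decorated_shape t p : (forall j, (j < leaves t)%N -> p j =
  nth (CLeaf gamma) (leaf_seq t) j) ->
  decorated (shape t) p = t.
Proof.
elim: t p => [q|c l IHl r IHr] p /= H; first by rewrite H.
have ls : leaves (shape l) = leaves l by rewrite !nodes_leaves shape_nodes.
rewrite IHl => [|j jl]; last by rewrite H ?nth_cat ?size_leaf_seq ?jl // ltn_addr.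
rewrite IHr // => j jr; rewrite ls H ?ltn_add2l // nth_cat size_leaf_seq.
by rewrite ltnNge leq_addr /= addKn.
Qed.

(** Labels and leaves separate: the first factor only depends on the shape of [t], the second on its
    sequence of leaves. *)
Lemma eval_decorate t s p :
  eval_tree t (decorate s p) = relabel M^T (shape t) (fun s' =>
    (s' == s)%:R) * leaf_pairing (leaf_seq t) p.
Proof.
have NdE a l r g l1 r1 : (Nd a l r == Nd g l1 r1 :> tree)%:R =
  (a == g)%:R * ((l == l1)%:R * (r == r1)%:R) :> K.
  by rewrite -!natrM !mulnb; congr (nat_of_bool _)%:R;
    apply/eqP/and3P => [[-> -> ->] | [/eqP-> /eqP-> /eqP->]].
elim: t s p => [q|c l IHl r IHr] [[]|g s1 s2] p /=.
- by rewrite mul1r mulr1.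
- by rewrite mul0r.
- rewrite big1 ?mul0r // => a _.
  by rewrite (_ : relabel _ _ _ = 0) ?mulr0 // -[RHS](relabel0 M^T (shape l));
    apply: eq_relabel => l'; rewrite -[RHS](relabel0 M^T (shape r)).
rewrite (bigD1 g) //= [X in (_ + X) * _]big1 ?addr0 => [|a ag]; last first.
  rewrite (_ : relabel _ _ _ = 0) ?mulr0 // -[RHS](relabel0 M^T (shape l));
    apply: eq_relabel => l'.
  by rewrite -[RHS](relabel0 M^T (shape r)); apply: eq_relabel => r';
    rewrite NdE (negbTE ag) mul0r.
rewrite IHl IHr [M^T c g]mxE leaf_pairing_cat size_leaf_seq -!mulrA; congr (_ * _).
have -> : relabel M^T (shape l) (fun l' => relabel M^T (shape r) (fun r' =>
  (Nd g l' r' == Nd g s1 s2)%:R)) =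
    relabel M^T (shape l) (fun l' => (l' == s1)%:R) * relabel M^T (shape r) (fun r' =>
      (r' == s2)%:R).
  rewrite mulrC -relabelZ; apply: eq_relabel => l'; rewrite mulrC -relabelZ;
    apply: eq_relabel => r'.
  by rewrite NdE eqxx mul1r.
(* If the left subtrees have different sizes, the decorations are cut at different places, but the
   first factor is then zero. *)
have [->|ne] := eqVneq (leaves s1) (leaves l); first by ring.
have -> : relabel M^T (shape l) (fun l' => (l' == s1)%:R) = 0; last by rewrite !mul0r.
rewrite -[RHS](relabel0 M^T (shape l)); apply: relabel_ext => l' nl _.
case: eqP => // e; case/eqP: ne; rewrite -e !nodes_leaves nl shape_nodes //.
Qed.

Lemma kappa_tensor t w (x : free w.+1) (p : nat -> homog P) :
  kappa t (tensor (R := R) x p) = relabel M^T (shape t) (tree_coef x) * leaf_pairing (leaf_seq t) p.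
Proof.
rewrite [LHS]kappaE; move: x; apply: linear_ext => [k u v|k u v|s].
- by rewrite mlift_is_linear eval_lin_is_linear.
- rewrite regular_scaleE mulrA -mulrDl; congr (_ * _); rewrite -relabelZ -relabelD;
  apply: eq_relabel => s.
  by rewrite /tree_coef; case: insub => [s'|]; rewrite ?mulr0 ?addr0 // coefD coefZ.
rewrite mlift_basis eval_linU eval_decorate; congr (_ * _); apply: eq_relabel => s'.
rewrite /tree_coef; case: insubP => [s'' _ e|ns]; first by rewrite coef_basis -e eq_sym.
by case: eqP => // e; case/negP: ns; rewrite e; apply: (valP s).
Qed.

Lemma leaf_pairing_ar l p : leaf_pairing l p != 0 ->
  sumn (map (@corolla_ar gamma) l) = (\sum_(j < size l) tag (p j))%N.
Proof.
elim: l p => [|q l IH] p /=; first by rewrite big_ord0.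
rewrite mulf_eq0 negb_or big_ord_recl => /andP[q0 /IH ->]; congr (_ + _)%N.
move: q0; case: (p 0%N) => n u /= q0; apply/eqP; apply: contraNT q0 => /eqP ne.
by apply/eqP; apply: corolla_coord_ar.
Qed.

Lemma leaf_pairing_dual l l' : size l = size l' ->
  leaf_pairing l (fun j => dual_leaf K (nth (CLeaf gamma) l' j)) = (l == l')%:R.
Proof.
elim: l l' => [|q l IH] [|q' l'] //= [sl].
by rewrite homog_coord_dual IH // -natrM mulnb eqseq_cons.
Qed.

Lemma chain_support w n (z : comp) : koszul_chain (R := R) w n z ->
  forall t, kappa t z != 0 -> leaves t = w.+1 /\ total_ar t = n.
Proof.
elim=> [|k x y [x' [p [_ pn ->]]] _ IH] t.
  by rewrite (linear_fun0 (@kappa_is_linear K gamma t)) eqxx.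
have [y0|y1] := eqVneq (kappa t y) 0; last by move=> _; apply: IH.
rewrite kappa_is_linear y0 addr0 kappa_tensor => nz.
have : relabel M^T (shape t) (tree_coef x') * leaf_pairing (leaf_seq t) p != 0.
  by apply: contraNneq nz => ->; rewrite scaler0.
rewrite mulf_eq0 negb_or => /andP[Tn /leaf_pairing_ar].
have lt : leaves t = w.+1.
  apply/eqP; apply: contraNT Tn => ne; rewrite -(relabel0 M^T (shape t)); apply/eqP;
    apply: relabel_ext => s ns _.
  rewrite /tree_coef insubF //; apply/negbTE; apply: contraNN ne => /=.
  by rewrite !nodes_leaves ns shape_nodes.
by rewrite total_ar_leaf_seq size_leaf_seq lt pn.
Qed.

Lemma rotation_graft t t' : rotation t t' -> exists (c : tree) i d s1 s2 s3,
  [/\ (i < leaves c)%N, shape t = graft c i (Nd d (Nd d s1 s2) s3),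
      shape t' = graft c i (Nd d s1 (Nd d s2 s3)) & leaf_seq t = leaf_seq t'].
Proof.
elim=> {t t'} [d x y z|g l l' r _ [c [i [d [s1 [s2 [s3 [ic E E' L]]]]]]]|g l r r' _ [c [i [d [s1 [s2 [s3 [ic E E' L]]]]]]]].
- by exists leaf, 0%N, d, (shape x), (shape y), (shape z); split=> //=; rewrite catA.
- exists (Nd g c (shape r)), i, d, s1, s2, s3; split=> /=.
  + by rewrite ltn_addr.
  + by rewrite ic E.
  + by rewrite ic E'.
  + by rewrite L.
- exists (Nd g (shape l) c), (leaves (shape l) + i)%N, d, s1, s2, s3; split=> /=.
  + by rewrite ltn_add2l.
  + by rewrite ltnNge leq_addr /= addKn E.
  + by rewrite ltnNge leq_addr /= addKn E'.
  + by rewrite L.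
Qed.

Lemma chain_rotation w n (z : comp) : koszul_chain (R := R) w n z ->
  rotation_invariant (fun t => tree_sign K t * (kappa t z : K)).
Proof.
move=> zc t t' tt'; elim: zc => [|k x y [x' [p [x'd _ ->]]] _ IH].
  by rewrite !(linear_fun0 (@kappa_is_linear K gamma _)) !mulr0.
rewrite !kappa_is_linear !regular_scaleE !mulrDr IH; congr (_ + _).
rewrite !(mulrCA _ k); congr (_ * _); rewrite !kappa_tensor.
have [c [i [d [s1 [s2 [s3 [ic E E' ->]]]]]]] := rotation_graft tt'.
rewrite !mulrA; congr (_ * _); rewrite /tree_sign -!shape_left_nodes E E' left_nodes_rotation.
have /eqP := koszul_dual_rotation x'd d s1 s2 s3 ic.
rewrite addr_eq0 => /eqP ->; rewrite mulrN mulNr mulNr opprK.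
have ss : (-1) ^+ nodes s1 * (-1) ^+ nodes s1 =
  1 :> K by rewrite -exprD addnn -signr_odd odd_double.
by rewrite mulrACA ss mul1r.
Qed.

End Tensors.

(** * Exactness *)

Section Enumerations.
Variable gamma : nat.
Local Notation tree := (syntax_tree 'I_gamma).

(** Lists the trees of height at most [d], among which are those with at most [d] nodes. *)
Fixpoint tree_enum (d : nat) : seq tree :=
  if d is d'.+1 then
    leaf :: flatten [seq [seq Nd g l r | l <- tree_enum d',
      r <- tree_enum d'] | g <- enum 'I_gamma]
  else [:: leaf].

Lemma mem_tree_enum d (s : tree) : (nodes s <= d)%N -> s \in tree_enum d.
Proof.
elim: d s => [|d IH] [[]|g l r] //= sd; rewrite ?mem_head //.
rewrite in_cons; apply/orP; right; apply/flatten_mapP; exists g; first by rewrite mem_enum.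
by apply/allpairsP; exists (l, r); split=> //=; apply: IH; lia.
Qed.

Fixpoint decoration_enum (m n : nat) : seq (seq (corolla gamma)) :=
  if m is m'.+1 then
    flatten [seq [seq q :: l | q <- corollas gamma k,
      l <- decoration_enum m' (n - k)] | k <- iota 0 n.+1]
  else if n is 0 then [:: [::]] else [::].

Lemma mem_decoration_enum m n l : (l \in decoration_enum m n) =
  (size l == m) && (sumn (map (@corolla_ar gamma) l) == n).
Proof.
elim: m n l => [|m IH] n l /=; first by case: n l => [|n] [|q l].
apply/flatten_mapP/andP => [[k kn /allpairsP[[q l'] /= [qk]]]|].
  rewrite IH => /andP[/eqP <- /eqP e] ->; move: qk kn;
    rewrite mem_corollas mem_iota => /eqP qk kn.
  by split=> //=; rewrite e qk; lia.
case: l => [[]//|q l] /= [sl /eqP e]; exists (corolla_ar q).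
  by rewrite mem_iota; have := corolla_ar_gt0 q; lia.
apply/allpairsP; exists (q, l); split=> //=; first by rewrite mem_corollas.
by rewrite IH -eqSS sl /= -e addKn.
Qed.

End Enumerations.

Section Koszulness.
Variables (K : fieldType) (gamma : nat).
Local Notation P := (As K gamma).
Local Notation R := (@As_rel K gamma).
Local Notation M := (label_mx K gamma).
Local Notation V := (invmx (label_mx K gamma)).
Local Notation free := (free_operad 'I_gamma K).
Local Notation F := (free_set_operad 'I_gamma).
Local Notation tree := (syntax_tree 'I_gamma).
Local Notation dtree := (btree 'I_gamma (corolla gamma)).
Local Notation comp := (composite 'I_gamma P).
Implicit Types (q : corolla gamma) (t : dtree) (s : tree).

(** A tree with [m] leaves has m - 1 nodes, so it occurs in the enumeration; [undup] ensures that it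
    is counted once. *)
Definition free_of_coefs (m : nat) (X : tree -> K) : free m :=
  \sum_(s <- undup (pmap (insub : tree -> option (so_at F m)) (tree_enum gamma m)))
    X (val s) *: basis s.

Lemma tree_coef_free_of_coefs m (X : tree -> K) s :
  tree_coef (free_of_coefs m X) s = if leaves s == m then X s else 0.
Proof.
rewrite /tree_coef; case: insubP => [u us e|/negbTE /= ->] //.
have -> : (leaves s == m) = true by exact: us.
rewrite -e {us e}.
rewrite /free_of_coefs coef_sum; under eq_bigr => v _ do rewrite coefZ coef_basis.
rewrite (bigD1_seq u) ?undup_uniq //=; last first.
  rewrite mem_undup mem_pmap; apply/mapP; exists (val u); last by rewrite valK.
  have ul : leaves (val u) = m by apply/eqP: (valP u).
  by apply: mem_tree_enum; rewrite -ltnS -nodes_leaves; apply/leqW/eq_leq.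
by rewrite eqxx mulr1 big1 ?addr0 // => v /negbTE ->; rewrite mulr0.
Qed.

Lemma rotation_decorated (c : tree) i d s1 s2 s3 p : (i < leaves c)%N ->
  rotation (decorated (graft c i (Nd d (Nd d s1 s2) s3)) p : dtree)
    (decorated (graft c i (Nd d s1 (Nd d s2 s3))) p).
Proof.
elim: c i p => [[]|g l IHl r IHr] i p /= ic.
  have -> : (fun j => p (leaves s1 + leaves s2 + j)%N) = (fun j =>
    p (leaves s1 + (leaves s2 + j))%N).
    by apply: funext => j; rewrite addnA.
  exact: rotation_root.
case: ltnP => il /=.
  have -> : leaves (graft l i (Nd d (Nd d s1 s2) s3)) =
    leaves (graft l i (Nd d s1 (Nd d s2 s3))).
    by apply: succn_inj; rewrite !leaves_graft //= -!addnA.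
  by apply: rotation_l; apply: IHl.
by apply: rotation_r; apply: IHr; rewrite ltn_subLR.
Qed.

(** The converse of [chain_support] and [chain_rotation]. For a fixed sequence [l] of leaves, [y] is
    a function of the shape, hence gives an element [x l] of the Koszul dual, which is tensored with
    the elements dual to [l]. Finitely many [l] occur, since their length is w + 1 and their arities
    add up to [n]. *)
Lemma chain_of_coordinates w n (y : dtree -> K) : rotation_invariant y ->
  (forall t, y t != 0 -> leaves t = w.+1 /\ total_ar t = n) ->
  exists2 z : comp, koszul_chain (R := R) w n z & forall t, kappa t z = tree_sign K t * y t.
Proof.
move=> yI ys.
pose Y l s : K := (-1) ^+ left_nodes s * y (decorated s (nth (CLeaf gamma) l)).
have Y0 l s : leaves s <> w.+1 -> Y l s = 0.
  move=> ls; rewrite /Y; case: (eqVneq (y (decorated s (nth (CLeaf gamma) l))) 0) => [->|/ys[]].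
    by rewrite mulr0.
  by rewrite decorated_leaves.
pose x l : free w.+1 := free_of_coefs w.+1 (fun s => relabel V^T s (Y l)).
have xE l s : tree_coef (x l) s = relabel V^T s (Y l).
  rewrite tree_coef_free_of_coefs; case: eqP => // ls.
  rewrite -[LHS](relabel0 V^T s); apply: relabel_ext => s' ns _; rewrite Y0 // => ls';
    apply: ls.
  by rewrite -ls' !nodes_leaves ns.
have xd l : koszul_dual R (x l).
  apply: rotation_koszul_dual (xE l) => c i d s1 s2 s3 ic.
  rewrite /Y (yI _ _ (rotation_decorated _ _ _ _ _ ic)) left_nodes_rotation.
  by ring.
pose D := undup (decoration_enum gamma w.+1 n).
pose T l : comp := tensor (R := R) (x l) (fun j => dual_leaf K (nth (CLeaf gamma) l j)).
exists (\sum_(l <- D) T l) => [|t].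
  rewrite big_seq; apply: span_sum => l;
    rewrite mem_undup mem_decoration_enum => /andP[/eqP sl /eqP ln].
  apply: span_sub; exists (x l), (fun j => dual_leaf K (nth (CLeaf gamma) l j)); split=> //.
  rewrite -ln -sl sumnE big_map (big_nth (CLeaf gamma)) big_mkord.
  by apply: eq_bigr => j _; case: (nth _ _ _).
rewrite (linear_fun_sum _ _ _ (@kappa_is_linear K gamma t)).
have TE l : kappa t (T l) = Y l (shape t) * leaf_pairing (leaf_seq t) (fun j =>
  dual_leaf K (nth (CLeaf gamma) l j)).
  rewrite kappa_tensor; congr (_ * _).
  rewrite (@eq_relabel _ _ _ _ _ (fun s => relabel V^T s (Y l))) => [|s]; last exact: xE.
  by rewrite relabel_mul -trmx_mul mulVmx ?label_mx_unit // trmx1 relabel1.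
transitivity (\sum_(l <- D) Y l (shape t) * leaf_pairing (leaf_seq t) (fun j =>
  dual_leaf K (nth (CLeaf gamma) l j))).
  by apply: eq_bigr => l _; apply: TE.
clear TE T.
have [yt|yt] := eqVneq (y t) 0; last first.
  have [lt nt] := ys _ yt.
  have tD : leaf_seq t \in D.
    by rewrite mem_undup mem_decoration_enum size_leaf_seq -total_ar_leaf_seq lt nt !eqxx.
  rewrite (bigD1_seq (leaf_seq t)) ?undup_uniq //= leaf_pairing_dual // eqxx mulr1.
  rewrite big1_seq ?addr0 => [|l /andP[lt' lD]].
    by rewrite /Y shape_left_nodes decorated_shape.
  rewrite leaf_pairing_dual; first by rewrite eq_sym (negbTE lt') mulr0.
  by move: lD; rewrite mem_undup mem_decoration_enum size_leaf_seq lt => /andP[/eqP].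
rewrite yt mulr0 big1_seq // => l /=; rewrite mem_undup mem_decoration_enum => /andP[/eqP sl _].
have [ls|ls] := eqVneq (leaves (shape t)) w.+1; last by rewrite Y0 ?mul0r //; apply/eqP.
rewrite leaf_pairing_dual; last by rewrite size_leaf_seq sl -ls !nodes_leaves shape_nodes.
have [e|ne] := eqVneq (leaf_seq t) l; last by rewrite mulr0.
by rewrite /Y -e decorated_shape // yt mulr0 mul0r.
Qed.

Lemma kappa_ext (z z' : comp) :
  (forall t, kappa t z = kappa t z') -> z = z'.
Proof.
move=> e; apply/eqP; rewrite -subr_eq0; apply/eqP/kappa_inj => t.
by rewrite (linear_funB (@kappa_is_linear K gamma t)) e subrr.
Qed.

Theorem As_koszul : koszul R.
Proof.
move=> n n1 w z zc dz; pose u t : K := tree_sign K t * (kappa t z : K).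
have uI : rotation_invariant u := chain_rotation zc.
have us t : u t != 0 -> leaves t = w.+1 /\ total_ar t = n.
  by rewrite mulf_eq0 negb_or => /andP[_]; apply: chain_support zc _.
have u0 t : splits t u = 0.
  have := kappa_diff t z; rewrite dz (linear_fun0 (@kappa_is_linear K gamma t)) => e.
  by rewrite -[LHS]mul1r -(tree_signK K t) -mulrA -[X in _ * X]e mulr0.
(* As [u] is a cycle, D S + S D = 1 makes this a primitive of [u]. *)
pose y t := merges t u.
have ys t : y t != 0 -> leaves t = w.+2 /\ total_ar t = n.
  have y0 : (forall s : dtree, (leaves s).+1 = leaves t -> total_ar s = total_ar t -> u s =
    0) -> y t = 0.
    by move=> us0; rewrite -[RHS](merges0 K t); apply: merges_ext.
  move=> yt; split; apply: contra_neq_eq yt => ne; apply: y0 => s ls ns.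
    by have [->|/us[ls' _]] := eqVneq (u s) 0 => //; rewrite -ls ls' eqxx in ne.
  by have [->|/us[_ ns']] := eqVneq (u s) 0 => //; rewrite -ns ns' eqxx in ne.
have yu t : splits t y = u t.
  (* The homotopy formula fails on the unit tree, but [u] vanishes there because the total arity [n]
     exceeds 1. *)
  have [->|t1] := pselect (t = Lf (CLeaf gamma)).
    by have [//|/us[_ /= e]] := eqVneq (u (Lf (CLeaf gamma))) 0; rewrite -e in n1.
  rewrite -(splits_merges t1 uI) -[LHS]addr0; congr (_ + _).
  by rewrite -[LHS](merges0 K t); apply: merges_eq.
have [z' z'c z'y] := chain_of_coordinates (merges_rotation uI) ys.
exists z' => //; apply: kappa_ext => t; rewrite kappa_diff.
rewrite (@splits_eq _ _ _ _ y) => [|s]; last by rewrite z'y mulrA tree_signK mul1r.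
by rewrite yu mulrA tree_signK mul1r.
Qed.

End Koszulness.

Theorem proposition5p1p1 (K : fieldType) (charK0 : [pchar K]%R =i pred0) (gamma : nat) :
  [/\ operad_iso (As K gamma) (corolla_operad K gamma),
      koszul (@As_rel K gamma)
    & PBW_basis (@As_rel K gamma) (@monochrome_right_comb gamma)].
Proof.
split; first exact: As_operad_iso.
  exact: As_koszul.
exact: As_PBW.
Qed.
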